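(* For every $\varepsilon>0$, $$\sup_{p\in[2,\infty]}\ \sup_{d\in\mathbb{N}}\ \sup_{G\in\mathcal{F}_d}\Big\|\sup_{t>0,\ \widetilde{\kappa}(tG)\le d^{-\varepsilon}}|\mathcal{M}_t^G|\Big\|_{\ell^p(\mathbb{Z}^d)\to\ell^p(\mathbb{Z}^d)}<\infty.$$ That is, for every $\varepsilon>0$ there is a constant $C_\varepsilon<\infty$ such that for all $p\in[2,\infty]$, $d\in\mathbb{N}$, $G\in\mathcal{F}_d$ and $f\in\ell^p(\mathbb{Z}^d)$, the $\ell^p(\mathbb{Z}^d)$ norm of $x\mapsto\sup\{|\mathcal{M}_t^Gf(x)|:t>0,\ \widetilde{\kappa}(tG)\le d^{-\varepsilon}\}$ is at most $C_\varepsilon\|f\|_{\ell^p(\mathbb{Z}^d)}$.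
   Context: A convex body in $\mathbb{R}^d$ is a closed, bounded, convex set with non-empty interior. It is 1-symmetric if it is invariant under all coordinate permutations and under all coordinate sign changes $x\mapsto(\epsilon_1x_1,\dots,\epsilon_dx_d)$, $\epsilon\in\{-1,1\}^d$. $\mathcal{F}_d$ is the family of all 1-symmetric convex bodies in $\mathbb{R}^d$. $|x|_1=\sum_{i=1}^d|x_i|$; $\widetilde{\kappa}(G)=\max_{x\in G\cap\mathbb{Z}^d}|x|_1/d$; $tG=\{tx:x\in G\}$. For $f:\mathbb{Z}^d\to\mathbb{C}$, $x\in\mathbb{Z}^d$ and $t>0$, $$\mathcal{M}_t^Gf(x)=\frac{1}{|tG\cap\mathbb{Z}^d|}\sum_{y\in tG\cap\mathbb{Z}^d}f(x-y).$$ *)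

(* Defs.v *)
From HB Require Import structures.
From mathcomp Require Import all_boot all_order all_algebra all_fingroup.
From mathcomp Require Import finmap.
From mathcomp Require Import all_classical all_reals all_analysis.
From mathcomp Require Import complex.

Set Implicit Arguments.
Unset Strict Implicit.
Unset Printing Implicit Defensive.

Import Order.TTheory GRing.Theory Num.Theory.
Import numFieldNormedType.Exports.

Local Open Scope classical_set_scope.
Local Open Scope ring_scope.

(* Z^d, under its own name so that it can carry the discrete sigma-algebra
   needed to speak of Lnorm with respect to the counting measure. *)
Definition lattice (d : nat) : Type := 'rV[int]_d.

HB.instance Definition _ (d : nat) := GRing.Zmodule.on (lattice d).
HB.instance Definition _ (d : nat) :=
  isPointed.Build (lattice d) (0 : 'rV[int]_d).
HB.instance Definition _ (d : nat) :=
  @isMeasurable.Build default_measure_display (lattice d)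
    discrete_measurable discrete_measurable0
    discrete_measurableC discrete_measurableU.

Section bodies.
Context {R : realType} {d : nat}.
Implicit Types G : set 'rV[R]_d.

Definition convex_body G : Prop :=
  [/\ closed G, bounded_set G,
      convex_set (G : set (convex_lmodType 'rV[R]_d)) & G° !=set0].

Definition one_symmetric G : Prop :=
  (forall (s : 'S_d) (x : 'rV[R]_d), G x -> G (col_perm s x)) /\
  (forall (e : 'I_d -> bool) (x : 'rV[R]_d),
     G x -> G (\row_i ((-1) ^+ e i * x ord0 i))).

Definition sym_convex_bodies : set (set 'rV[R]_d) :=
  [set G | convex_body G /\ one_symmetric G].

Definition dilate (t : R) G : set 'rV[R]_d := [set t *: x | x in G].

Definition l1norm (x : 'rV[R]_d) : R := \sum_(i < d) `|x ord0 i|.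

Definition of_lattice (x : lattice d) : 'rV[R]_d := map_mx intr (x : 'rV[int]_d).

(* fset_set is the enumeration of a finite set and is empty on infinite sets;
   for bounded G the set on the right is finite. *)
Definition lattice_points G : {fset lattice d} :=
  fset_set [set x : lattice d | G (of_lattice x)].

(* The neutral element 0 does not affect the maximum, whose terms are
   nonnegative. *)
Definition kappa G : R :=
  \big[Num.max/0]_(x <- lattice_points G) (l1norm (of_lattice x) / d%:R).

Definition average (t : R) G (f : lattice d -> R[i]) (x : lattice d) : R[i] :=
  (#|` lattice_points (dilate t G)|%:R)^-1 *
  \sum_(y <- lattice_points (dilate t G)) f (x - y).

(* For a bounded G containing 0 the set of admissible t contains all small t,
   so the supremum is never taken over the empty set. *)
Definition maximal (eps : R) G (f : lattice d -> R[i]) (x : lattice d) : \bar R :=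
  ereal_sup [set (ComplexField.Normc.normc (average t G f x))%:E |
             t in [set t : R | 0 < t /\
                               kappa (dilate t G) <= d%:R `^ (- eps)]].

Definition lpnorm (p : \bar R) (g : lattice d -> \bar R) : \bar R :=
  Lnorm counting p g.

Definition lpnormC (p : \bar R) (f : lattice d -> R[i]) : \bar R :=
  lpnorm p (fun x => (ComplexField.Normc.normc (f x))%:E).

End bodies.

(* Main.v *)
(** By Jensen's inequality the case p >= 2 follows from the case p = 2 applied to
    |f|^(p/2), and p = oo is trivial.

    Let p = 2.  Lattice points y of tG satisfy |y|_1 <= d^(1-eps).  Replacing an
    entry m of y by m - 1 and a zero entry by 1 or -1 does not leave tG, and
    counting such moves shows that all but a fraction 1/d of the points have
    entries bounded by some L depending only on eps; the contribution of the
    exceptional points is summed trivially over dyadic values of #(tG).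

    If the entries of y are bounded by L, the average of f(x - wy) over the signed
    permutations w can be computed by first splitting the coordinates at random
    into L blocks of size N and placing the entries of absolute value m in the
    m-th block.  The two translations of Z by m and -m average to the mean of two
    involutions, so that the entries of one block become a spherical average on a
    Hamming cube {0,1}^N with at most N/64 flips, and it remains to bound the
    maximal function of these spherical averages on l^2, uniformly in N.

    The spherical average S_n is compared with the mean of S_j under the binomial
    weights B(2n, 1/2), which is an average over permutations of conditional
    expectations along an increasing chain of sets of coordinates and so is
    controlled by Doob's inequality.  The difference is bounded by a square
    function: the multipliers of S_n are normalised Krawtchouk polynomials K_n,
    and at a character of weight a = xN <= N/2 the three-term recurrence gives
    |K_n| <= (1 - x/4)^n and |K_n - K_(n+1)| <= 3x(1 - x/4)^n.  Characters of
    weight above N/2 are reduced to this case by the modulation (-1)^|J|. *)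

Require Import Defs.
From HB Require Import structures.
From mathcomp Require Import all_boot all_order all_algebra all_fingroup.
From mathcomp Require Import finmap.
From mathcomp Require Import all_classical all_reals all_analysis.
From mathcomp Require Import complex ess_sup_inf.
From mathcomp Require Import ring lra zify.

Set Implicit Arguments.
Unset Strict Implicit.
Unset Printing Implicit Defensive.

Import Order.TTheory GRing.Theory Num.Theory.
Import numFieldNormedType.Exports.

Local Open Scope ring_scope.

(** * Normalised Krawtchouk polynomials *)

(* K n is the value of the n-th normalised Krawtchouk polynomial at a set of
   size x N, characterised by its three-term recurrence. *)
Section krawtchouk_bounds.
Variables (R : realFieldType) (N : nat) (x rho : R) (K : nat -> R).
Hypotheses (x0 : 0 <= x) (x2 : x <= 2^-1) (rhoE : rho = 1 - x / 4).
Hypotheses (K0 : K 0 = 1) (K1 : K 1 = 1 - 2 * x).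
Hypothesis KS : forall n, (n.+1 < N)%N ->
  (N%:R - n.+1%:R) * K n.+2 = (1 - 2 * x) * N%:R * K n.+1 - n.+1%:R * K n.

Lemma kraw_rho : 7 / 8 <= rho <= 1.
Proof. by move: x0 x2; rewrite rhoE; lra. Qed.

(** Induction on [n]. Since [K] decreases, the recurrence gives [K n.+2 <= (1 - 2 * x) * K n.+1].
    The lower bound of the previous step, in the form [K n <= 2 * K n.+1], together with n + 1 <= N
    / 32 keeps the subtracted term small enough for the factor 1/2 to survive. *)
Lemma kraw_ratio n : x <= 8^-1 -> (32 * n <= N)%N -> (0 < N)%N ->
  0 < K n /\ 2^-1 * K n <= K n.+1 <= (1 - 2 * x) * K n.
Proof.
move=> x8 nN N0; have xx := x0; have xx2 := x2.
elim: n nN => [_|n IH nN]; first by rewrite K0 K1; split; lra.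
have [|K_gt0 /andP[Kl Ku]] := IH; first by clear -nN; lia.
have KS_gt0 : 0 < K n.+1 by lra.
split=> //.
have nN' : 32 * n.+1%:R <= N%:R :> R by rewrite -natrM ler_nat; clear -nN; lia.
have n0 : 0 < n.+1%:R :> R by rewrite ltr0n.
have N0' : 0 < N%:R - n.+1%:R :> R by lra.
have /KS : (n.+1 < N)%N by clear -nN; lia.
set v := N%:R in nN' N0' *; set u := n.+1%:R in nN' n0 N0' *;
  move: v u nN' n0 N0' => v u nN' n0 N0'.
move=> eqK.
have e2 : (v - u) * K n.+2 <= (v - u) * ((1 - 2 * x) * K n.+1).
  rewrite eqK.
  have xK : 0 <= x * K n by rewrite mulr_ge0 // ltW.
  have uK : 0 <= u * (K n - K n.+1) by rewrite mulr_ge0 ?(ltW n0) // subr_ge0; lra.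
  have : 0 <= u * x * K n.+1 by rewrite !mulr_ge0 // ltW.
  lra.
have e1 : (v - u) * (2^-1 * K n.+1) <= (v - u) * K n.+2.
  rewrite eqK.
  have : u * K n <= u * (2 * K n.+1) by rewrite ler_pM2l //; lra.
  have : 0 <= (8^-1 - x) * (v * K n.+1) by rewrite !mulr_ge0 //; lra.
  have : 32 * u * K n.+1 <= v * K n.+1 by rewrite ler_pM2r.
  have : 0 <= u * K n.+1 by rewrite mulr_ge0 // ltW.
  lra.
by rewrite -(ler_pM2l N0') e1 -(ler_pM2l N0') e2.
Qed.

(* For small x the ratios K (n+1) / K n stay in [1/2, 1 - 2x]; for larger x the
   triangle inequality in the recurrence is enough. *)
Lemma kraw_decay n : (32 * n <= N + 32)%N -> (0 < N)%N -> `|K n| <= rho ^+ n.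
Proof.
move=> nN N0; have xx := x0; have xx2 := x2.
have /andP[rl ru] := kraw_rho.
have r0 : 0 <= rho by lra.
have [x8|x8] := lerP x 8^-1.
  suff : 0 <= K n <= rho ^+ n by case/andP=> h1 h2; rewrite ger0_norm.
  elim: n nN => [_|n IH nN]; first by rewrite K0 expr0; lra.
  have [K_gt0 /andP[Kl Ku]] := @kraw_ratio n x8 ltac:(clear -nN; lia) N0.
  have /andP[_ Kn] := IH ltac:(clear -nN; lia).
  apply/andP; split; first by lra.
  rewrite exprS; apply: (le_trans Ku).
  apply: ler_pM => //; rewrite ?rhoE; lra.
(* The recurrence has order two, so two consecutive values are carried through the induction. *)
suff : `|K n| <= rho ^+ n /\ ((32 * n <= N)%N -> `|K n.+1| <= rho ^+ n.+1) by case.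
elim: n nN => [_|n IH nN].
  by rewrite K0 expr0 normr1; split => // _; rewrite K1 expr1 ler_norml rhoE; lra.
have [IH1 IH2] := IH ltac:(clear -nN; lia).
have {}IH2 := IH2 ltac:(clear -nN; lia).
split=> // nN2.
have nN' : 32 * n.+1%:R <= N%:R :> R by rewrite -natrM ler_nat; clear -nN2; lia.
have n0 : 0 < n.+1%:R :> R by rewrite ltr0n.
have N0' : 0 < N%:R - n.+1%:R :> R by lra.
have /KS : (n.+1 < N)%N by clear -nN2; lia.
set v := N%:R in nN' N0' *; set u := n.+1%:R in nN' n0 N0' *;
  move: v u nN' n0 N0' => v u nN' n0 N0'.
move=> eqK; rewrite -(ler_pM2l N0') -{1}(gtr0_norm N0') -normrM eqK.
apply: (le_trans (ler_normB _ _)); rewrite (normrM _ (K n.+1)) (normrM u).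
have xv : 0 <= (1 - 2 * x) * v by rewrite mulr_ge0 //; lra.
rewrite (gtr0_norm n0) (ger0_norm xv).
move: IH2 IH1; rewrite !exprS; set q := rho ^+ n => IH2 IH1.
have q0 : 0 <= q by rewrite exprn_ge0.
have h1 : ((1 - 2 * x) * v) * `|K n.+1| <= ((1 - 2 * x) * v) * (rho * q).
  by rewrite ler_wpM2l.
have h2 : u * `|K n| <= u * q by rewrite ler_pM2l.
apply: (le_trans (lerD h1 h2)).
(* For x > 1/8 one has 1 - 2x <= 3/4 against rho >= 7/8; the gap v rho / 8 absorbs the terms in [u],
   because v >= 32 u. *)
suff : ((1 - 2 * x) * v) * rho + u <= (v - u) * (rho * rho).
  by move=> h; have := ler_wpM2r q0 h; lra.
have h3 : ((1 - 2 * x) * v) * rho <= (3/4) * v * rho by rewrite ler_wpM2r // ler_wpM2r //; lra.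
have h4 : v * (rho * (7/8)) <= v * (rho * rho) by rewrite !ler_wpM2l //; lra.
have h5 : u * (rho * rho) <= u by rewrite -{2}(mulr1 u) ler_pM2l //; nra.
have h6 : v * (7/8) <= v * rho by rewrite ler_wpM2l //; lra.
lra.
Qed.

(** For differences the recurrence reads (N - n - 1)(K_(n+1) - K_(n+2)) = 2xN K_(n+1) + (n + 1)(K_n
    - K_(n+1)). The decay of [K] controls the first term and induction the second. *)
Lemma kraw_diff n : (32 * n <= N)%N -> (0 < N)%N ->
  `|K n - K n.+1| <= 3 * x * rho ^+ n.
Proof.
move=> nN N0; have xx := x0; have xx2 := x2.
have /andP[rl ru] := kraw_rho.
have r0 : 0 <= rho by lra.
elim: n nN => [_|n IH nN].
  by rewrite K0 K1 expr0 ler_norml; lra.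
have {}IH := IH ltac:(clear -nN; lia).
have nN' : 32 * n.+1%:R <= N%:R :> R by rewrite -natrM ler_nat; clear -nN; lia.
have n0 : 0 < n.+1%:R :> R by rewrite ltr0n.
have N0' : 0 < N%:R - n.+1%:R :> R by lra.
have /KS : (n.+1 < N)%N by clear -nN; lia.
have Kn : `|K n.+1| <= rho ^+ n.+1 by apply: kraw_decay => //; clear -nN; lia.
set v := N%:R in nN' N0' *; set u := n.+1%:R in nN' n0 N0' *;
  move: v u nN' n0 N0' => v u nN' n0 N0'.
move=> eqK; rewrite -(ler_pM2l N0') -{1}(gtr0_norm N0') -normrM mulrBr eqK.
have -> : (v - u) * K n.+1 - (((1 - 2 * x) * v) * K n.+1 - u * K n)
  = 2 * (x * v) * K n.+1 + u * (K n - K n.+1) by ring.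
have xv : 0 <= 2 * (x * v) by rewrite !mulr_ge0 //; lra.
apply: (le_trans (ler_normD _ _)); rewrite (normrM _ (K n.+1)) (normrM u) (gtr0_norm n0)
  (ger0_norm xv).
move: Kn IH; rewrite !exprS; set q := rho ^+ n => Kn IH.
have q0 : 0 <= q by rewrite exprn_ge0.
have h1 : 2 * (x * v) * `|K n.+1| <= 2 * (x * v) * (rho * q) by rewrite ler_wpM2l.
have h2 : u * `|K n - K n.+1| <= u * (3 * x * q) by rewrite ler_pM2l.
apply: (le_trans (lerD h1 h2)).
suff : 2 * v * rho + 3 * u <= (v - u) * (3 * rho).
  move=> h; have xq : 0 <= x * q by rewrite mulr_ge0.
  by have := ler_wpM2r xq h; lra.
have h4 : v * (7/8) <= v * rho by rewrite ler_wpM2l //; lra.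
have h5 : u * rho <= u by rewrite -{2}(mulr1 u) ler_pM2l.
lra.
Qed.

End krawtchouk_bounds.

(** * Weighted Cauchy-Schwarz and moments of the binomial weights *)

Lemma sum_sqr_le (R : realFieldType) (I : Type) (r : seq I) (P : pred I) (w u : I -> R) :
  (forall i, P i -> 0 <= w i) ->
  (\sum_(i <- r | P i) w i * u i) ^+ 2 <=
  (\sum_(i <- r | P i) w i) * \sum_(i <- r | P i) w i * u i ^+ 2.
Proof.
move=> w0; set S := \sum_(i <- r | P i) w i * u i; set W := \sum_(i <- r | P i) w i.
set Q := \sum_(i <- r | P i) w i * u i ^+ 2.
have [W0|W0] := eqVneq W 0.
  have : 0 <= W by exact: sumr_ge0.
  suff -> : S = 0 by rewrite W0 expr0n mul0r.
  move: W0; rewrite /W /S; elim: r {S W Q} => [|i r IH]; first by rewrite !big_nil.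
  rewrite !big_cons; case: ifP => // Pi.
  move/eqP; rewrite paddr_eq0 ?w0 ?sumr_ge0 // => /andP[/eqP-> /eqP/IH->].
  by rewrite mul0r addr0.
have Wp : 0 < W by rewrite lt0r W0 sumr_ge0.
have : 0 <= \sum_(i <- r | P i) w i * (u i * W - S) ^+ 2.
  by apply: sumr_ge0 => i Pi; rewrite mulr_ge0 ?w0 ?sqr_ge0.
have -> : \sum_(i <- r | P i) w i * (u i * W - S) ^+ 2 = W * (W * Q - S ^+ 2).
  under eq_bigr => i _.
    have -> : w i * (u i * W - S) ^+ 2 =
      W ^+ 2 * (w i * u i ^+ 2) - (2 * W * S) * (w i * u i) + S ^+ 2 * w i by ring.
    over.
  rewrite big_split sumrB /= -!mulr_sumr -/S -/Q -/W; ring.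
by rewrite pmulr_rge0 // subr_ge0.
Qed.

Lemma sum_bin_pow (R : pzSemiRingType) m : \sum_(j < m.+1) 'C(m, j)%:R = 2 ^+ m :> R.
Proof.
have := Pascal 1 1 m; rewrite -natrX => ->; rewrite natr_sum.
by apply: eq_bigr => j _; rewrite !exp1n !muln1.
Qed.

(** A sum of [m] independent signs has variance [m]; Pascal's rule splits off one sign at a time. *)
Lemma sum_bin_dev (R : comPzRingType) m :
  \sum_(j < m.+1) 'C(m, j)%:R * (2 * j%:R - m%:R) ^+ 2 = m%:R * 2 ^+ m :> R.
Proof.
elim: m => [|m IH]; first by rewrite big_ord1 /= bin0 !mulr0 subrr expr0n mulr0 mul0r.
have step (phi : nat -> R) : \sum_(j < m.+2) 'C(m.+1, j)%:R * phi j =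
    \sum_(j < m.+1) 'C(m, j)%:R * (phi j + phi j.+1).
  rewrite big_ord_recl /= bin0.
  under eq_bigr => j _ do rewrite binS natrD mulrDl.
  rewrite big_split /= addrA.
  under [RHS]eq_bigr => j _ do rewrite mulrDr.
  rewrite big_split /=; congr (_ + _).
  rewrite [RHS]big_ord_recl /= bin0; congr (_ + _).
  by rewrite big_ord_recr /= bin_small // mul0r addr0.
rewrite (step (fun j => (2 * j%:R - m.+1%:R) ^+ 2)).
under eq_bigr => j _.
  have -> : 'C(m, j)%:R * ((2 * j%:R - m.+1%:R) ^+ 2 + (2 * j.+1%:R - m.+1%:R) ^+ 2) =
    2 * ('C(m, j)%:R * (2 * j%:R - m%:R) ^+ 2) + 2 * 'C(m, j)%:R :> R.
    by rewrite -!natr1; ring.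
  over.
by rewrite big_split /= -!mulr_sumr IH sum_bin_pow exprS -natr1; ring.
Qed.

Lemma sum_inv_sqr_le2 (R : realFieldType) M : \sum_(n < M) (n.+1%:R ^- 2) <= 2 :> R.
Proof.
(* This stronger bound telescopes, as 1/(m+1)^2 <= 1/m - 1/(m+1). *)
suff : \sum_(n < M.+1) (n.+1%:R ^- 2) <= 2 - (M.+1%:R)^-1 :> R.
  rewrite big_ord_recr /= => h; have : 0 <= M.+1%:R ^- 2 :> R by rewrite invr_ge0 exprn_ge0.
  have : 0 <= (M.+1%:R)^-1 :> R by rewrite invr_ge0.
  move: h; move: (\sum_(i < M) _) (M.+1%:R ^- 2) (M.+1%:R^-1 : R) => s p q; lra.
elim: M => [|M IH]; first by rewrite big_ord1 expr1n invr1; lra.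
rewrite big_ord_recr /=; apply: (le_trans (lerD IH (lexx _))).
have m0 : 0 < M.+1%:R :> R by rewrite ltr0n.
rewrite -[M.+2%:R]natr1; move: (M.+1%:R : R) m0 => m m0.
rewrite -subr_ge0.
have -> : 2 - (m + 1)^-1 - (2 - m^-1 + (m + 1) ^- 2) = (m * (m + 1) ^+ 2)^-1.
  by field; rewrite !lt0r_neq0 //; lra.
by rewrite invr_ge0 mulr_ge0 ?sqr_ge0 // ltW.
Qed.

Lemma sum_arith_geom (R : realFieldType) (rho : R) M : 0 <= rho <= 1 ->
  (1 - rho) ^+ 2 * \sum_(n < M) n%:R * rho ^+ n <= 1.
Proof.
move=> /andP[r0 r1].
suff -> : (1 - rho) ^+ 2 * \sum_(n < M) n%:R * rho ^+ n =
   rho - rho ^+ M.+1 - M%:R * rho ^+ M * (1 - rho).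
  have : 0 <= M%:R * rho ^+ M * (1 - rho) by rewrite !mulr_ge0 ?exprn_ge0 ?subr_ge0.
  have : 0 <= rho ^+ M.+1 by rewrite exprn_ge0.
  by lra.
elim: M => [|M IH]; first by rewrite big_ord0; ring.
by rewrite big_ord_recr /= mulrDr IH !exprS -natr1; ring.
Qed.

Definition binw (R : realFieldType) m j : R := 'C(m, j)%:R / 2 ^+ m.

Lemma binw_ge0 (R : realFieldType) m j : 0 <= binw R m j.
Proof. by rewrite divr_ge0 ?exprn_ge0. Qed.

Lemma sum_binw (R : realFieldType) m : \sum_(j < m.+1) binw R m j = 1.
Proof. by rewrite -mulr_suml sum_bin_pow divff // expf_neq0 // pnatr_eq0. Qed.

(** The law B(2n, 1/2) has mean [n] and variance n/2, so it concentrates near the radius [n] with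
    which it is compared. *)
Lemma binw_var (R : realFieldType) n :
  \sum_(j < n.*2.+1) binw R n.*2 j * (j%:R - n%:R) ^+ 2 = n%:R / 2.
Proof.
have E (m j : nat) : binw R m j * (2 * j%:R - m%:R) ^+ 2 =
    'C(m, j)%:R * (2 * j%:R - m%:R) ^+ 2 / 2 ^+ m by rewrite /binw mulrAC.
have n2 : n.*2%:R = 2 * n%:R :> R by rewrite -mul2n natrM.
have /(congr1 (fun z => z / 2 ^+ n.*2 / 4)) := sum_bin_dev R n.*2.
rewrite mulfK ?expf_neq0 ?pnatr_eq0 // !mulr_suml n2 => h.
transitivity ((2 * n%:R) / 4 : R); last by field.
by rewrite -h; apply: eq_bigr => j _; rewrite -n2 -E n2; field.
Qed.

(** * Square-summable distance between Krawtchouk values and their binomial means *)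

Section krawtchouk_square_sum.
Variables (R : realFieldType) (N : nat) (x rho : R) (K : nat -> R).
Hypotheses (x0 : 0 <= x) (x2 : x <= 2^-1) (rhoE : rho = 1 - x / 4).
Hypotheses (K0 : K 0 = 1) (K1 : K 1 = 1 - 2 * x).
Hypothesis KS : forall n, (n.+1 < N)%N ->
  (N%:R - n.+1%:R) * K n.+2 = (1 - 2 * x) * N%:R * K n.+1 - n.+1%:R * K n.


Lemma kraw_dist i j : (0 < N)%N -> (i <= j)%N -> (32 * j <= N)%N ->
  `|K i - K j| <= (j%:R - i%:R) * (3 * x * rho ^+ i).
Proof.
move=> N0 /subnK <-; elim: (j - i)%N => [|m IH] h.
  by rewrite add0n !subrr normr0 mul0r.
have -> : K i - K (m.+1 + i) = (K i - K (m + i)) + (K (m + i) - K (m + i).+1).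
  by rewrite addSn; ring.
apply: (le_trans (ler_normD _ _)).
have h1 := IH ltac:(lia).
have h2 := kraw_diff x0 x2 rhoE K0 K1 KS (n := m + i) ltac:(lia) N0.
have /andP[rl ru] := kraw_rho x0 x2 rhoE.
have r0 : 0 <= rho by lra.
have h3 : rho ^+ (m + i) <= rho ^+ i.
  by rewrite exprD ler_piMl ?exprn_ge0 ?exprn_ile1 //; lra.
have h4 : 3 * x * rho ^+ (m + i) <= 3 * x * rho ^+ i.
  by rewrite ler_wpM2l // mulr_ge0.
by rewrite addSn -[(_ + _).+1%:R]natr1; lra.
Qed.

(* Chebyshev's inequality disposes of the j < n / 2, where K j has not decayed. *)
Lemma kraw_binw_term n : (0 < n)%N -> (64 * n <= N)%N ->
  (K n - \sum_(j < n.*2.+1) binw R n.*2 j * K j) ^+ 2 <=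
  9 * x ^+ 2 * (n%:R * rho ^+ n) + 32 * n%:R ^- 2.
Proof.
move=> n0 nN; have N0 : (0 < N)%N by lia.
have /andP[rl ru] := kraw_rho x0 x2 rhoE.
have nR : 0 < n%:R :> R by rewrite ltr0n.
have r0 : 0 <= rho by lra.
set b := binw R n.*2.
have b0 j : 0 <= b j by exact: binw_ge0.
(* [u] keeps the terms with j >= n/2. For the others |K n - K j| <= 2 is paid for by the deviation,
   since (j - n)^2 >= n^2/4. *)
set u := fun j : nat => if (n <= j.*2)%N then `|K n - K j| else 0.
(* The index [j] runs up to 2n, so 64n <= N keeps it in the range of the decay estimate. *)
have K_le1 j : (32 * j <= N)%N -> `|K j| <= 1.
  move=> hj; apply: (le_trans (kraw_decay x0 x2 rhoE K0 K1 KS _ N0)); first by lia.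
  by apply: exprn_ile1.
have E1 (j : 'I_(n.*2.+1)) : `|K n - K j| <= u j + 8 * n%:R ^- 2 * (j%:R - n%:R) ^+ 2.
  rewrite /u; case: leqP => hj.
    by rewrite lerDl mulr_ge0 ?sqr_ge0 // mulr_ge0 // invr_ge0 sqr_ge0.
  rewrite add0r; apply: (le_trans (ler_normB _ _)).
  have := K_le1 n ltac:(lia); have := K_le1 j ltac:(lia).
  suff : 2 <= 8 * n%:R ^- 2 * (j%:R - n%:R) ^+ 2 :> R by lra.
  have hj' : 2 * j%:R <= n%:R :> R by rewrite -natrM ler_nat; lia.
  rewrite mulrAC ler_pdivlMr ?exprn_gt0 //.
  have j0 : 0 <= j%:R :> R by [].
  move: (j%:R : R) (n%:R : R) hj' j0 nR => p q h p0 q0.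
  have : 0 <= (q - 2 * p) * (3 * q - 2 * p) by rewrite mulr_ge0 //; lra.
  by nra.
have E2 (j : 'I_(n.*2.+1)) : u j ^+ 2 <= 9 * x ^+ 2 * rho ^+ n * (j%:R - n%:R) ^+ 2.
  have P0 : 0 <= 9 * x ^+ 2 * rho ^+ n * (j%:R - n%:R) ^+ 2.
    by rewrite mulr_ge0 ?sqr_ge0 // mulr_ge0 ?exprn_ge0 // mulr_ge0 ?sqr_ge0.
  have jn := ltn_ord j.
  rewrite /u; case: leqP => hj; last by rewrite expr0n.
  (* Here 2 min(j, n) >= n, so the square of rho^min(j, n) is at most rho^n. *)
  have key i : (n <= i.*2)%N -> (rho ^+ i) ^+ 2 <= rho ^+ n.
    by move=> /subnK; rewrite -exprM muln2 => <-;
      rewrite exprD ler_piMl ?exprn_ge0 ?exprn_ile1 //.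
  have fin l (D : R) : (n <= l.*2)%N -> D ^+ 2 = (j%:R - n%:R) ^+ 2 ->
      `|K n - K j| <= D * (3 * x * rho ^+ l) ->
      `|K n - K j| ^+ 2 <= 9 * x ^+ 2 * rho ^+ n * (j%:R - n%:R) ^+ 2.
    move=> hi eD le; apply: (@le_trans _ _ ((D * (3 * x * rho ^+ l)) ^+ 2)).
      by rewrite lerXn2r // ?nnegrE //; apply: le_trans le.
    rewrite !exprMn eD; have := key l hi; move: ((rho ^+ l) ^+ 2) => t ht.
    have -> : (j%:R - n%:R) ^+ 2 * (3 ^+ 2 * x ^+ 2 * t) = (9 * x ^+ 2 * (j%:R - n%:R) ^+ 2) *
      t by ring.
    rewrite (mulrAC _ (rho ^+ n)); apply: ler_wpM2l => //.
    by rewrite mulr_ge0 ?sqr_ge0 // mulr_ge0 ?sqr_ge0.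
  case: (leqP n j) => hnj.
    by apply: (fin n _ ltac:(lia) (erefl _)); apply: kraw_dist => //; lia.
  apply: (fin j (n%:R - j%:R) hj); first by ring.
  by rewrite distrC; apply: kraw_dist => //; lia.
set U := \sum_(j < n.*2.+1) b j * u j.
have U2 : U ^+ 2 <= 9 * x ^+ 2 * rho ^+ n * (n%:R / 2).
  rewrite /U; apply: (le_trans (sum_sqr_le _ (fun j : 'I_(n.*2.+1) => u j) _)) => [j _|];
    first exact: b0.
  rewrite sum_binw mul1r -binw_var mulr_sumr; apply: ler_sum => j _.
  by rewrite [leRHS]mulrCA; apply: ler_wpM2l; rewrite ?b0 ?E2.
have TU : `|K n - \sum_(j < n.*2.+1) b j * K j| <= U + 4 / n%:R.
  have -> : K n - \sum_(j < n.*2.+1) b j * K j = \sum_(j < n.*2.+1) b j * (K n - K j).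
    under [RHS]eq_bigr do rewrite mulrBr.
    by rewrite sumrB -mulr_suml sum_binw mul1r.
  apply: (le_trans (ler_norm_sum _ _ _)).
  have -> : 4 / n%:R = 8 * n%:R ^- 2 * (n%:R / 2) :> R by field; rewrite lt0r_neq0.
  rewrite -binw_var mulr_sumr -big_split /=; apply: ler_sum => j _.
  rewrite normrM ger0_norm //; apply: (le_trans (ler_wpM2l (b0 j) (E1 j))).
  by rewrite le_eqVlt; apply/orP; left; apply/eqP; rewrite /b; ring.
rewrite -real_normK ?num_real //.
apply: (@le_trans _ _ ((U + 4 / n%:R) ^+ 2)).
  by rewrite lerXn2r // ?nnegrE //; apply: le_trans TU.
have -> : 32 * n%:R ^- 2 = 2 * (4 / n%:R) ^+ 2 :> R by field; rewrite lt0r_neq0.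
by have := sqr_ge0 (U - 4 / n%:R); nra.
Qed.

Lemma kraw_binw_sum M : (forall n, (n < M)%N -> (64 * n <= N)%N) ->
  \sum_(n < M) (K n - \sum_(j < n.*2.+1) binw R n.*2 j * K j) ^+ 2 <= 208.
Proof.
case: M => [|M] MN; first by rewrite big_ord0.
rewrite big_ord_recl /= big_ord1 K0 /binw bin0 expr0 divr1 mulr1 subrr expr0n add0r.
apply: (@le_trans _ _ (\sum_(n < M) (9 * x ^+ 2 * (n.+1%:R * rho ^+ n.+1) + 32 * n.+1%:R ^- 2))).
  apply: ler_sum => n _; apply: (@kraw_binw_term n.+1) => //; apply: MN.
  by rewrite ltnS ltn_ord.
rewrite big_split /= -!mulr_sumr.
have := sum_inv_sqr_le2 R M.
have /andP[rl ru] := kraw_rho x0 x2 rhoE.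
have := @sum_arith_geom R rho M.+1 ltac:(lra).
rewrite big_ord_recl mul0r add0r /=.
(* As x = 4(1 - rho), the first series contributes at most 144 and the second 32 * 2, in total
   208. *)
have -> : 9 * x ^+ 2 = 144 * (1 - rho) ^+ 2 by rewrite rhoE; field.
rewrite -mulrA; lra.
Qed.

End krawtchouk_square_sum.

(** * Walsh analysis on the cube *)

Section symmetric_difference.
Variable T : finType.
Implicit Types A B C I J : {set T}.

(** Group law of the cube: subsets of [T] are its points, and adding a set toggles the coordinates
    in it. *)
Definition symd A B : {set T} := [set x | (x \in A) (+) (x \in B)].

Lemma in_symd A B x : (x \in symd A B) = (x \in A) (+) (x \in B).
Proof. by rewrite inE. Qed.

Lemma symdA A B C : symd A (symd B C) = symd (symd A B) C.
Proof. by apply/setP => x; rewrite !in_symd addbA. Qed.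

Lemma symdC A B : symd A B = symd B A.
Proof. by apply/setP => x; rewrite !in_symd addbC. Qed.

Lemma symds0 A : symd A finset.set0 = A.
Proof. by apply/setP => x; rewrite in_symd inE addbF. Qed.

Lemma symd0s A : symd finset.set0 A = A.
Proof. by rewrite symdC symds0. Qed.

Lemma symdd A : symd A A = finset.set0.
Proof. by apply/setP => x; rewrite in_symd inE addbb. Qed.

Lemma symdK A : involutive (symd A).
Proof. by move=> B; rewrite symdA symdd symd0s. Qed.

Lemma symd_eq0 A B : (symd A B == finset.set0) = (A == B).
Proof.
apply/eqP/eqP => [h|->]; last exact: symdd.
by apply: (inv_inj (symdK A)); rewrite h symdd.
Qed.

Lemma card_symd1 i A :
  #|symd [set i] A| = if i \in A then #|A|.-1 else #|A|.+1.
Proof.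
case: ifPn => iA.
  suff -> : symd [set i] A = A :\ i by rewrite (cardsD1 i A) iA.
  apply/setP => x; rewrite in_symd !inE.
  by case: eqVneq => [->|]; rewrite ?iA.
suff -> : symd [set i] A = i |: A by rewrite cardsU1 iA.
apply/setP => x; rewrite in_symd !inE.
by case: eqVneq => [->|]; rewrite ?(negPf iA).
Qed.

Lemma sum_symd (V : nmodType) A (F : {set T} -> V) :
  \sum_B F (symd A B) = \sum_B F B.
Proof. by rewrite [RHS](reindex_inj (inv_inj (symdK A))). Qed.

Lemma card_subsets : #|{: {set T}}| = (2 ^ #|T|)%N.
Proof.
rewrite -[in RHS]cardsT -card_powerset; apply: eq_card => A.
by rewrite !inE finset.subsetT.
Qed.

Lemma symd_subset A B J : A \subset J -> B \subset J -> symd A B \subset J.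
Proof.
move=> /fintype.subsetP hA /fintype.subsetP hB; apply/fintype.subsetP => x; rewrite in_symd.
by move: (hA x) (hB x); case: (x \in A); case: (x \in B) => //=; auto.
Qed.

Lemma sum_symd_sub (V : nmodType) A J (F : {set T} -> V) : A \subset J ->
  \sum_(B : {set T} | B \subset J) F (symd A B) = \sum_(B : {set T} | B \subset J) F B.
Proof.
move=> AJ; rewrite [RHS](reindex_inj (inv_inj (symdK A))) /=; apply: eq_bigl => B.
apply/idP/idP => h; first exact: symd_subset.
by rewrite -(symdK A B); exact: symd_subset.
Qed.

(** Induction on the size of A minus B: transposing a point of A outside B with a point of B outside
    A lowers it by one. *)
Lemma perm_imset_eq A B : #|A| = #|B| -> exists s : {perm T}, s @: A = B.
Proof.
move: {2}(#|A :\: B|) (erefl #|A :\: B|) => n.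
elim: n A => [|n IH] A hn hAB.
  exists 1%g; rewrite -[RHS]imset_id; under eq_imset do rewrite perm1.
  rewrite !imset_id; apply/eqP; rewrite eqEcard hAB leqnn andbT.
  by rewrite -finset.setD_eq0 -cards_eq0 hn.
have [x xAB] : exists x, x \in A :\: B by apply/set0Pn; rewrite -cards_eq0 hn.
have [y yBA] : exists y, y \in B :\: A.
  apply/set0Pn; rewrite -cards_eq0.
  have := cardsID B A; have := cardsID A B; rewrite finset.setIC; lia.
have [xA xB] : x \in A /\ x \notin B by move: xAB; rewrite inE => /andP[].
have [yB yA] : y \in B /\ y \notin A by move: yBA; rewrite inE => /andP[].
pose A' := tperm x y @: A.
have A'E : A' = y |: (A :\ x).
  apply/setP => z; rewrite !inE; apply/imsetP/idP => [[w wA ->]|].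
    case: tpermP => [_|wy|wx wy]; rewrite ?eqxx //.
      by move: wA yA; rewrite wy => ->.
    by move/eqP: wx => /negPf ->; rewrite wA orbT.
  case/orP => [/eqP->|/andP[zx zA]]; first by exists x; rewrite ?tpermL.
  exists z => //; rewrite tpermD // 1?eq_sym //.
  by apply: contraNneq yA => <-.
have [||s hs] := IH A'.
- suff -> : A' :\: B = (A :\: B) :\ x by have := cardsD1 x (A :\: B); rewrite xAB hn; lia.
  apply/setP => z; rewrite A'E !inE.
  by case: (eqVneq z y) => [->|_]; rewrite ?yB ?andbF //=; case: (z == x); case: (z \in B).
- by rewrite card_imset //; exact: perm_inj.
exists (tperm x y * s)%g; rewrite -hs -imset_comp; apply: eq_imset => z /=.
by rewrite permM.
Qed.

End symmetric_difference.

Section walsh.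
Variables (R : realFieldType) (T : finType).
Implicit Types (A B C I J : {set T}) (f g u : {set T} -> R).
Local Notation N := #|T|.

(** The character of the cube given by the parity of the intersection of [A] and [J]; the product
    form makes its multiplicativity a coordinatewise fact. *)
Definition chi A J : R := \prod_(i : T) (-1) ^+ ((i \in A) && (i \in J)).

Lemma chiC A J : chi A J = chi J A.
Proof. by apply: eq_bigr => i _; rewrite andbC. Qed.

Lemma chiM A I J : chi A (symd I J) = chi A I * chi A J.
Proof.
rewrite -big_split /=; apply: eq_bigr => i _.
by rewrite in_symd andb_addr signr_addb.
Qed.

Lemma chi0 A : chi A finset.set0 = 1.
Proof. by rewrite /chi big1 // => i _; rewrite inE andbF. Qed.

Lemma chi1 A i : chi A [set i] = (-1) ^+ (i \in A).
Proof.
rewrite /chi (bigD1 i) //= inE eqxx andbT big1 ?mulr1 // => j /negPf ji.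
by rewrite inE ji andbF.
Qed.

Lemma chi_sqr A J : chi A J ^+ 2 = 1.
Proof. by rewrite expr2 -chiM symdd chi0. Qed.

Lemma chiT J : chi finset.setT J = (-1) ^+ #|J|.
Proof.
rewrite /chi; under eq_bigr do rewrite inE andTb.
by rewrite prodrXr -sum1_card [in RHS]big_mkcond.
Qed.

(** If [i] lies in [A], toggling [i] in [J] reverses the sign of every term. *)
Lemma sum_chi A : \sum_J chi A J = if A == finset.set0 then 2 ^+ N else 0.
Proof.
case: eqVneq => [->|/set0Pn[i iA]].
  under eq_bigr do rewrite chiC chi0.
  by rewrite sumr_const card_subsets natrX.
have : \sum_J chi A J = - \sum_J chi A J.
  rewrite -{1}(sum_symd [set i]) -sumrN; apply: eq_bigr => J _.
  by rewrite chiM chi1 iA mulN1r.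
by move=> h; lra.
Qed.

Definition walsh g A := \sum_J g J * chi A J.

Lemma walshK g J : walsh (walsh g) J = 2 ^+ N * g J.
Proof.
rewrite /walsh; under eq_bigr do rewrite mulr_suml.
rewrite exchange_big /= (bigD1 J) //= [X in _ + X]big1 ?addr0 => [|I IJ].
  under eq_bigr do rewrite -mulrA (chiC J) -expr2 chi_sqr mulr1.
  by rewrite sumr_const card_subsets -(mulr_natl (g J)) natrX.
under eq_bigr do rewrite -mulrA (chiC J) -chiM chiC.
by rewrite -mulr_sumr sum_chi symd_eq0 (negPf IJ) mulr0.
Qed.

Lemma walsh_parseval g : \sum_A walsh g A ^+ 2 = 2 ^+ N * \sum_J g J ^+ 2.
Proof.
rewrite mulr_sumr; under [RHS]eq_bigr => J _ do rewrite expr2 mulrA -walshK mulr_suml.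
rewrite exchange_big /=; apply: eq_bigr => A _; rewrite expr2 {2}/walsh mulr_sumr.
by apply: eq_bigr => J _; rewrite (chiC J); ring.
Qed.

Definition sphere n g J := 'C(N, n)%:R^-1 * \sum_(I : {set T} | #|I| == n) g (symd J I).

Definition kraw n A : R := 'C(N, n)%:R^-1 * \sum_(I : {set T} | #|I| == n) chi A I.

(** A spherical mean is a convolution on the group of subsets, hence diagonal in the characters. *)
Lemma walsh_sphere n g A : walsh (sphere n g) A = kraw n A * walsh g A.
Proof.
rewrite /walsh /sphere /kraw.
under eq_bigr do rewrite -mulrA mulr_suml.
rewrite -mulr_sumr -mulrA; congr (_ * _).
rewrite exchange_big mulr_suml; apply: eq_bigr => I _ /=.
rewrite -(sum_symd I) mulr_sumr; apply: eq_bigr => J _.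
by rewrite chiM (symdC I J) -symdA symdd symds0; ring.
Qed.

Lemma walsh_lin (I : Type) (r : seq I) (P : pred I) (c : I -> R) (F : I -> {set T} -> R) A :
  walsh (fun J => \sum_(i <- r | P i) c i * F i J) A =
  \sum_(i <- r | P i) c i * walsh (F i) A.
Proof.
rewrite /walsh; under eq_bigr do rewrite mulr_suml.
rewrite exchange_big; apply: eq_bigr => i _; rewrite mulr_sumr.
by apply: eq_bigr => J _; rewrite mulrA.
Qed.

Lemma walshB f g A : walsh (fun J => f J - g J) A = walsh f A - walsh g A.
Proof. by rewrite /walsh; under eq_bigr do rewrite mulrBl; rewrite sumrB. Qed.

Lemma sum_sign A : \sum_(i : T) (-1) ^+ (i \in A) = N%:R - 2 * #|A|%:R :> R.
Proof.
under eq_bigr => i _.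
  have -> : (-1) ^+ (i \in A) = 1 - 2 * (i \in A)%:R :> R.
    by case: (i \in A); rewrite /= ?expr0 ?expr1; ring.
  over.
rewrite sumrB sumr_const -mulr_sumr; congr (_ - _ * _).
by rewrite -natr_sum -sum1_card [in RHS]big_mkcond.
Qed.

Local Notation e n A := (\sum_(I : {set T} | #|I| == n) chi A I).

(* Multiplying the n-th layer sum by the sum of all signs toggles one element
   of the set, which lands in layer n+1 or in layer n-1. *)
Lemma kraw_layer n A :
  (N%:R - 2 * #|A|%:R) * e n A =
  n.+1%:R * e n.+1 A + (if n is m.+1 then (N - m)%:R * e m A else 0).
Proof.
rewrite -sum_sign mulr_suml.
transitivity (\sum_(i : T) \sum_(I : {set T} | #|symd [set i] I| == n) chi A I).
  apply: eq_bigr => i _; rewrite mulr_sumr (reindex_inj (inv_inj (symdK [set i]))) /=.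
  by apply: eq_bigr => I _; rewrite -chi1 -chiM symdK.
rewrite (exchange_big_dep predT) //=.
transitivity (\sum_(I : {set T}) chi A I *
   (((#|I| == n.+1) * #|I|)%N%:R + ((#|I|.+1 == n) * (N - #|I|))%N%:R)).
  apply: eq_bigr => I _; rewrite sumr_const -(mulr_natr (chi A I)) -natrD; congr (_ * _%:R).
  transitivity #|[set i | #|symd [set i] I| == n]|; first by rewrite cardsE.
  rewrite -[LHS](cardsID I); congr (_ + _)%N.
    case: eqVneq => h; rewrite ?mul1n ?mul0n.
      by apply: eq_card => i; rewrite !inE card_symd1; case: ifP; rewrite ?andbF // h eqxx.
    apply: eq_card0 => i; rewrite !inE card_symd1; case: ifP => iI; rewrite ?andbF //.
    have : (0 < #|I|)%N by apply/card_gt0P; exists i.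
    by move=> I0; rewrite andbT -eqSS prednK // (negPf h).
  case: eqVneq => h; rewrite ?mul1n ?mul0n.
    transitivity #|~: I|; last by rewrite cardsCs finset.setCK.
    apply: eq_card => i; rewrite !inE card_symd1.
    by case: ifP; rewrite ?h ?eqxx ?andbF.
  apply: eq_card0 => i; rewrite !inE card_symd1; case: ifP => iI //=.
  by rewrite (negPf h).
under [LHS]eq_bigr => I _ do rewrite mulrDr.
rewrite big_split /=; congr (_ + _).
  rewrite mulr_sumr [RHS]big_mkcond; apply: eq_bigr => I _ /=.
  by case: eqVneq => [->|_]; rewrite ?mul1n ?mul0n ?mulr0 // mulrC.
case: n => [|m]; first by rewrite big1 // => I _; rewrite mul0n mulr0.
rewrite mulr_sumr [RHS]big_mkcond; apply: eq_bigr => I _ /=; rewrite eqSS.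
by case: eqVneq => [->|_]; rewrite ?mul1n ?mul0n ?mulr0 // mulrC.
Qed.

Lemma kraw0 A : kraw 0 A = 1.
Proof.
rewrite /kraw bin0 invr1 mul1r (big_pred1 finset.set0) ?chi0 // => I.
by rewrite cards_eq0.
Qed.

Lemma krawE n A : (n <= N)%N -> 'C(N, n)%:R * kraw n A = e n A.
Proof. by move=> h; rewrite mulrA divff ?mul1r // pnatr_eq0 -lt0n bin_gt0. Qed.

Lemma kraw1 A : (0 < N)%N -> kraw 1 A = 1 - 2 * (#|A|%:R / N%:R).
Proof.
move=> N0; have := kraw_layer 0 A; rewrite -!krawE // kraw0 bin0 bin1 addr0 !mulr1 mul1r => h.
have N0' : N%:R != 0 :> R by rewrite pnatr_eq0 -lt0n.
by apply: (mulfI N0'); rewrite -h; field.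
Qed.

Lemma kraw_rec n A : (n.+1 < N)%N ->
  (N%:R - n.+1%:R) * kraw n.+2 A =
  (1 - 2 * (#|A|%:R / N%:R)) * N%:R * kraw n.+1 A - n.+1%:R * kraw n A.
Proof.
move=> nN.
have N0' : N%:R != 0 :> R by rewrite pnatr_eq0 -lt0n; lia.
have C0 : 'C(N, n.+1)%:R != 0 :> R by rewrite pnatr_eq0 -lt0n bin_gt0 ltnW.
have := kraw_layer n.+1 A; rewrite -!krawE //; try lia.
(* The rule (k+1) C(N, k+1) = (N-k) C(N, k), for k = n+1 and k = n, turns all three layers into
   multiples of C(N, n+1). *)
have := mul_bin_left N n.+1 => /(congr1 (fun z => z%:R : R)); rewrite !natrM => h1.
have := mul_bin_left N n => /(congr1 (fun z => z%:R : R)); rewrite !natrM => h2.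
rewrite (mulrA n.+2%:R) h1 (mulrA (N - n)%:R) -h2 natrB; last by lia.
move=> h; apply: (mulfI C0).
have -> : 'C(N, n.+1)%:R * ((N%:R - n.+1%:R) * kraw n.+2 A) =
  (N%:R - n.+1%:R) * 'C(N, n.+1)%:R * kraw n.+2 A by ring.
have -> : (N%:R - n.+1%:R) * 'C(N, n.+1)%:R * kraw n.+2 A =
  (N%:R - 2 * #|A|%:R) * ('C(N, n.+1)%:R * kraw n.+1 A) - n.+1%:R * 'C(N, n.+1)%:R * kraw n A.
  by rewrite h; ring.
by field.
Qed.

End walsh.

(** * The spherical maximal function on the cube *)

Section doob.
Variables (R : realFieldType) (T : finType).
Implicit Types (A B I J : {set T}) (f g : {set T} -> R).

(** Conditional expectation given the coordinates outside [J]. *)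
Definition cexp J g I : R := (2 ^+ #|J|)^-1 * \sum_(B : {set T} | B \subset J) g (symd I B).

Lemma cexp_ge0 J g I : (forall I, 0 <= g I) -> 0 <= cexp J g I.
Proof. by move=> g0; rewrite mulr_ge0 ?invr_ge0 ?exprn_ge0 // sumr_ge0. Qed.

Lemma cexp_sym J f g : \sum_I f I * cexp J g I = \sum_I cexp J f I * g I.
Proof.
rewrite /cexp; under eq_bigr do rewrite mulrCA mulr_sumr.
under [RHS]eq_bigr do rewrite -mulrA mulr_suml.
rewrite -!mulr_sumr; congr (_ * _).
rewrite exchange_big [RHS]exchange_big /=; apply: eq_bigr => B _.
rewrite -(sum_symd B); apply: eq_bigr => I _.
by rewrite (symdC B I) -symdA symdd symds0.
Qed.

Lemma card_subsets_of J : \sum_(B : {set T} | B \subset J) (1 : R) = 2 ^+ #|J|.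
Proof. by rewrite sumr_const -natrX -card_powerset; congr (_%:R); apply: eq_card => B;
  rewrite inE. Qed.

Lemma cexp_tower J J' g I : J \subset J' -> cexp J (cexp J' g) I = cexp J' g I.
Proof.
move=> JJ'; rewrite {1}/cexp.
under eq_bigr => B BJ.
  have -> : cexp J' g (symd I B) = cexp J' g I * 1.
    rewrite /cexp mulr1; congr (_ * _).
    rewrite -[RHS](sum_symd_sub _ (fintype.subset_trans BJ JJ')).
    by apply: eq_bigr => B' _; rewrite symdA.
  over.
by rewrite -mulr_sumr card_subsets_of mulrCA mulVf ?mulr1 // expf_neq0 // pnatr_eq0.
Qed.

(* Duality: for F = E_(k(.)) g with a selection k, one has
   |F|^2 = <X, g> where X = sum_i E_i (F 1_(k(.) = i)), and the tower property
   gives |X|^2 <= 2 <F, X>. *)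
Lemma doob_selection M (J : nat -> {set T}) (k : {set T} -> 'I_M) g :
  (forall i j, (i <= j)%N -> J i \subset J j) -> (forall I, 0 <= g I) ->
  \sum_I cexp (J (k I)) g I ^+ 2 <= 4 * \sum_I g I ^+ 2.
Proof.
move=> Jmono g0.
pose F I := cexp (J (k I)) g I.
have F0 I : 0 <= F I by exact: cexp_ge0.
pose Fk (i : 'I_M) I := (k I == i)%:R * F I.
have Fk0 i I : 0 <= Fk i I by rewrite mulr_ge0.
pose X I := \sum_(i < M) cexp (J i) (Fk i) I.
have sumFk I : \sum_(i < M) Fk i I = F I.
  rewrite (bigD1 (k I)) //= /Fk eqxx mul1r big1 ?addr0 // => i /negPf ki.
  by rewrite eq_sym ki mul0r.
have FF : \sum_I F I ^+ 2 = \sum_I X I * g I.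
  transitivity (\sum_I \sum_(i < M) Fk i I * cexp (J i) g I).
    apply: eq_bigr => I _; rewrite expr2 -{1}sumFk mulr_suml; apply: eq_bigr => i _.
    by rewrite /Fk; case: eqVneq => [<-|]; rewrite ?mul0r.
  rewrite exchange_big /=; under eq_bigr do rewrite cexp_sym.
  by rewrite exchange_big /=; apply: eq_bigr => I _; rewrite mulr_suml.
(* Self-adjointness moves E_i onto E_j F_j, which E_i fixes by the tower property. *)
have pair_le (i j : 'I_M) : (i <= j)%N ->
    \sum_I cexp (J i) (Fk i) I * cexp (J j) (Fk j) I = \sum_I Fk i I * cexp (J j) (Fk j) I.
  move=> ij; rewrite -cexp_sym; apply: eq_bigr => I _.
  by rewrite cexp_tower // Jmono.
have diag (j : 'I_M) : \sum_I \sum_(i < M | (i <= j)%N) Fk i I * cexp (J j) (Fk j) I <=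
    \sum_I F I * cexp (J j) (Fk j) I.
  apply: ler_sum => I _; rewrite -mulr_suml ler_wpM2r //; first exact: cexp_ge0.
  rewrite -sumFk big_mkcond /=; apply: ler_sum => i _; case: ifP => // _; exact: Fk0.
have XX : \sum_I X I ^+ 2 <= 2 * \sum_I F I * X I.
  pose c (i j : 'I_M) := \sum_I cexp (J i) (Fk i) I * cexp (J j) (Fk j) I.
  have c0 i j : 0 <= c i j by apply: sumr_ge0 => I _; rewrite mulr_ge0 // cexp_ge0.
  have -> : \sum_I X I ^+ 2 = \sum_(j < M) \sum_(i < M) c i j.
    under eq_bigr do rewrite expr2 {2}/X mulr_sumr.
    rewrite exchange_big; apply: eq_bigr => j _ /=.
    by under eq_bigr do rewrite mulr_suml; rewrite exchange_big.
  have -> : \sum_I F I * X I = \sum_(j < M) \sum_I F I * cexp (J j) (Fk j) I.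
    by rewrite exchange_big; apply: eq_bigr => I _; rewrite mulr_sumr.
  apply: (@le_trans _ _ (2 * \sum_(j < M) \sum_(i < M | (i <= j)%N) c i j)); last first.
    rewrite ler_pM2l // ler_sum // => j _; apply: le_trans (diag j).
    rewrite [leRHS]exchange_big /=; apply: ler_sum => i ij; by rewrite /c pair_le.
  have -> : 2 * \sum_(j < M) \sum_(i < M | (i <= j)%N) c i j =
    \sum_(j < M) \sum_(i < M | (i <= j)%N) c i j + \sum_(j < M) \sum_(i < M | (j <= i)%N) c i j.
    rewrite mulr_natl mulr2n; congr (_ + _).
    rewrite (exchange_big_dep predT) //=; apply: eq_bigr => j _; apply: eq_bigr => i _.
    by apply: eq_bigr => I _; rewrite mulrC.
  rewrite -big_split /=; apply: ler_sum => j _.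
  rewrite (big_mkcond (fun i : 'I_M => i <= j)%N) (big_mkcond (fun i : 'I_M => j <= i)%N)
    -[leRHS]big_split /=; apply: ler_sum => i _.
  by case: leqP => ij; [rewrite lerDl; case: ifP | rewrite (ltnW ij) add0r].
have CS (u v : {set T} -> R) : (\sum_I u I * v I) ^+ 2 <= (\sum_I u I ^+ 2) * \sum_I v I ^+ 2.
  have [v0|vn] := eqVneq (\sum_I v I ^+ 2) 0.
    rewrite v0 mulr0; suff -> : \sum_I u I * v I = 0 by rewrite expr0n.
    apply: big1 => I _; move/eqP: v0; rewrite psumr_eq0 => [/allP/(_ I)|? _]; last exact: sqr_ge0.
    by rewrite mem_index_enum sqrf_eq0 => /(_ isT)/eqP ->; rewrite mulr0.
  have V0 : 0 < \sum_I v I ^+ 2 by rewrite lt0r vn sumr_ge0 // => I _; exact: sqr_ge0.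
  set V := \sum_I v I ^+ 2 in V0 *; set S := \sum_I u I * v I; set U := \sum_I u I ^+ 2.
  have : 0 <= \sum_I (V * u I - S * v I) ^+ 2 by apply: sumr_ge0 => I _; exact: sqr_ge0.
  have -> : \sum_I (V * u I - S * v I) ^+ 2 = V * (U * V - S ^+ 2).
    under eq_bigr => I _.
      have -> : (V * u I - S * v I) ^+ 2 =
        V ^+ 2 * u I ^+ 2 - 2 * V * S * (u I * v I) + S ^+ 2 * v I ^+ 2 by ring.
      over.
    by rewrite big_split sumrB /= -!mulr_sumr -/V -/S -/U; ring.
  by rewrite pmulr_rge0 // subr_ge0.
have CS1 := CS F X; have CS2 := CS X g.
change (\sum_I F I ^+ 2 <= 4 * \sum_I g I ^+ 2).
rewrite -FF in CS2; move: XX CS1 CS2.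
have : 0 <= \sum_I F I ^+ 2 by apply: sumr_ge0 => I _; exact: sqr_ge0.
have : 0 <= \sum_I X I ^+ 2 by apply: sumr_ge0 => I _; exact: sqr_ge0.
have : 0 <= \sum_I g I ^+ 2 by apply: sumr_ge0 => I _; exact: sqr_ge0.
have : 0 <= \sum_I F I * X I.
  by apply: sumr_ge0 => I _; rewrite mulr_ge0 // sumr_ge0 // => i _; exact: cexp_ge0.
move: (\sum_I F I ^+ 2) (\sum_I X I ^+ 2) (\sum_I g I ^+ 2) (\sum_I F I * X I).
move=> a x b s s0 b0 x0 a0 xs sax axb.
(* With a = |F|^2, x = |X|^2, b = |g|^2 and s = <F, X>: x^2 <= 4 s^2 <= 4ax gives x <= 4a, and then
   a^2 <= xb <= 4ab gives a <= 4b. *)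
have xa : x <= 4 * a.
  have [->|xn] := eqVneq x 0; first by lra.
  have xp : 0 < x by rewrite lt0r xn.
  rewrite -(ler_pM2l xp); have : x * x <= 4 * s ^+ 2 by nra.
  nra.
have [->|an] := eqVneq a 0; first by lra.
have ap : 0 < a by rewrite lt0r an.
rewrite -(ler_pM2l ap); have := ler_wpM2r b0 xa; nra.
Qed.

End doob.

Section cube_maximal.
Variables (R : realFieldType) (T : finType).
Implicit Types (A B I J : {set T}) (f g u : {set T} -> R).
Local Notation N := #|T|.

(** The image of [B] under a uniformly random permutation is a uniformly random set of the same
    size, since permutations act transitively on such sets. *)
Lemma avg_perm_imset (F : {set T} -> R) B :
  (#|{: {perm T}}|%:R)^-1 * \sum_(s : {perm T}) F (s @: B) =
  'C(N, #|B|)%:R^-1 * \sum_(I : {set T} | #|I| == #|B|) F I.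
Proof.
have PT0 : #|{: {perm T}}|%:R != 0 :> R.
  by rewrite pnatr_eq0 -lt0n; apply/card_gt0P; exists 1%g.
have C0 : 'C(N, #|B|)%:R != 0 :> R by rewrite pnatr_eq0 -lt0n bin_gt0 max_card.
have inv I : #|I| = #|B| -> \sum_(s : {perm T}) F (s @: I) = \sum_(s : {perm T}) F (s @: B).
  case/perm_imset_eq => t <-; rewrite [LHS](reindex_inj (mulgI t)) /=.
  apply: eq_bigr => s _; rewrite -imset_comp; congr (F _); apply: eq_imset => z /=.
  by rewrite permM.
have sum1 : \sum_(I : {set T} | #|I| == #|B|) (1 : R) = 'C(N, #|B|)%:R.
  by rewrite sumr_const -(cardsT T) -cards_draws -cardsE; congr (_%:R); apply: eq_card => I;
    rewrite !inE finset.subsetT.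
apply: (mulfI C0); rewrite [RHS]mulrA mulfV // mul1r -sum1 mulr_suml.
transitivity (\sum_(I : {set T} | #|I| == #|B|) (#|{: {perm T}}|%:R)^-1 * \sum_(s : {perm T}) F
  (s @: I)).
  by apply: eq_bigr => I /eqP/inv ->; rewrite mul1r.
rewrite -mulr_sumr exchange_big /= (eq_bigr (fun=> \sum_(I : {set T} | #|I| == #|B|) F I)) =>
  [|s _].
  by rewrite sumr_const -[X in _ * X]mulr_natl mulrA mulVf // mul1r.
rewrite [RHS](reindex_inj (imset_inj (@perm_inj _ s))) /=.
by apply: eq_bigl => I; rewrite card_imset //; exact: perm_inj.
Qed.

Definition initial_set k : {set T} := [set x | (enum_rank x < k)%N].

Lemma card_initial_set k : (k <= N)%N -> #|initial_set k| = k.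
Proof.
move=> kN; transitivity #|[set i : 'I_N | (i < k)%N]|.
  rewrite -(card_imset _ (@enum_rank_inj T)); apply: eq_card => i; rewrite !inE.
  apply/imsetP/idP => [[x]|ik]; first by rewrite inE => h ->.
  by exists (enum_val i); rewrite ?inE enum_valK.
rewrite -sum1dep_card -(big_ord_widen _ (fun=> 1%N)) // sum1_card card_ord //.
Qed.

Definition binsphere k u J := \sum_(j < k.+1) binw R k j * sphere j u J.

Lemma imset_perm_subset (s : {perm T}) A B : (s @: A \subset s @: B) = (A \subset B).
Proof.
apply/idP/idP => [/fintype.subsetP h|]; last exact: imsetS.
by apply/fintype.subsetP => x xA; have := h _ (imset_f s xA); rewrite mem_imset //;
  exact: perm_inj.
Qed.

(** A uniform subset of a [k]-set has size distributed as B(k, 1/2); after a random permutation it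
    is, given its size, uniform among all sets of that size. *)
Lemma binsphereE k u J : (k <= N)%N ->
  binsphere k u J =
  (#|{: {perm T}}|%:R)^-1 * \sum_(s : {perm T}) cexp (s @: initial_set k) u J.
Proof.
move=> kN.
transitivity ((#|{: {perm T}}|%:R)^-1 * \sum_(s : {perm T}) ((2 ^+ k)^-1 *
    \sum_(B : {set T} | B \subset initial_set k) u (symd J (s @: B)))); last first.
  congr (_ * _); apply: eq_bigr => s _; rewrite /cexp.
  rewrite card_imset ?card_initial_set //; last exact: perm_inj.
  rewrite [in RHS](reindex_inj (imset_inj (@perm_inj _ s))) /=; congr (_ * _).
  by apply: eq_bigl => B; rewrite imset_perm_subset.
rewrite -mulr_sumr mulrCA exchange_big /= mulr_sumr.
under [in RHS]eq_bigr do rewrite (avg_perm_imset (fun B => u (symd J B))).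
rewrite (partition_big (fun B : {set T} => inord #|B| : 'I_k.+1) predT) //=.
rewrite mulr_sumr; apply: eq_bigr => j _.
have inordE (B : {set T}) : B \subset initial_set k -> (inord #|B| == j) = (#|B| == j).
  move=> /subset_leq_card; rewrite card_initial_set // => Bk.
  by rewrite -val_eqE /= inordK.
transitivity ((2 ^+ k)^-1 *
    \sum_(B : {set T} | (B \subset initial_set k) && (#|B| == j)) sphere j u J).
  rewrite sumr_const /binw -[X in _ = _ * X]mulr_natl [RHS]mulrA -/(sphere j u J); congr (_ * _).
  rewrite mulrC; congr (_ * _%:R).
  have := cards_draws (initial_set k) j; rewrite card_initial_set // => <-; rewrite -[LHS]cardsE.
  by apply: eq_card => B; rewrite !inE.
congr (_ * _); rewrite [LHS]big_mkcond [RHS]big_mkcond /=; apply: eq_bigr => B _.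
case BV: (B \subset _) => //=; rewrite inordE //.
by case: eqP => // ->.
Qed.

Definition spectrally_low u := forall A, (N < 2 * #|A|)%N -> walsh u A = 0.

(** Letting the radius depend on the point linearises the maximal function. For one permutation the
    images of the initial sets form a chain, so [doob_selection] applies; convexity of the square
    passes to the mean over permutations. *)
Lemma binsphere_selection (k : {set T} -> nat) u : (forall J, k J <= N)%N ->
  \sum_J binsphere (k J) u J ^+ 2 <= 4 * \sum_J u J ^+ 2.
Proof.
move=> kN.
have PT0 : 0 < #|{: {perm T}}|%:R :> R.
  by rewrite ltr0n; apply/card_gt0P; exists 1%g.
pose au J := `|u J|.
have -> : \sum_J u J ^+ 2 = \sum_J au J ^+ 2.
  by apply: eq_bigr => J _; rewrite real_normK // num_real.
pose w := (#|{: {perm T}}|%:R)^-1 : R.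
have w1 : \sum_(s : {perm T}) w = 1.
  by rewrite sumr_const -[LHS]mulr_natl mulfV // lt0r_neq0.
have w0 : 0 <= w by rewrite invr_ge0 ltW.
pose E (s : {perm T}) J := cexp (s @: initial_set (k J)) au J.
apply: (@le_trans _ _ (\sum_J \sum_(s : {perm T}) w * E s J ^+ 2)).
  apply: ler_sum => J _; rewrite binsphereE // mulr_sumr.
  have h : `|\sum_(s : {perm T}) w * cexp (s @: initial_set (k J)) u J| <=
           \sum_(s : {perm T}) w * E s J.
    apply: (le_trans (ler_norm_sum _ _ _)); apply: ler_sum => s _.
    rewrite normrM (ger0_norm w0) ler_wpM2l // /E /cexp normrM ger0_norm ?invr_ge0 ?exprn_ge0 //.
    by rewrite ler_wpM2l ?invr_ge0 ?exprn_ge0 // ler_norm_sum.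
  rewrite -real_normK ?num_real //.
  apply: (@le_trans _ _ ((\sum_(s : {perm T}) w * E s J) ^+ 2)).
    by rewrite lerXn2r // ?nnegrE //; apply: le_trans h.
  by apply: (le_trans (sum_sqr_le _ _ (fun _ _ => w0))); rewrite w1 mul1r.
have -> : 4 * \sum_J au J ^+ 2 = \sum_(s : {perm T}) w * (4 * \sum_J au J ^+ 2).
  by rewrite -mulr_suml w1 mul1r.
rewrite exchange_big /=; apply: ler_sum => s _.
rewrite -mulr_sumr ler_wpM2l //.
have kN' J : (k J < N.+1)%N by rewrite ltnS.
apply: (@doob_selection R T N.+1 (fun i => s @: initial_set i) (fun J => Ordinal (kN' J)) au)
  => [i j ij|I];
  last exact: normr_ge0.
by rewrite imset_perm_subset; apply/fintype.subsetP => x; rewrite !inE => /leq_trans; apply.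
Qed.

(** The sphere of radius [n] is its binomial mean of parameter 2n plus an error, and the errors at
    all radii are summed in square. The constant is 424 = 2 * 4 + 2 * 208. *)
Lemma sphere_low_selection (k : {set T} -> nat) u : (0 < N)%N ->
  (forall J, 64 * k J <= N)%N -> spectrally_low u ->
  \sum_J sphere (k J) u J ^+ 2 <= 424 * \sum_J u J ^+ 2.
Proof.
move=> N0 kN ulow.
pose D n J := sphere n u J - binsphere n.*2 u J.
have WD n A : walsh (D n) A =
    (kraw R n A - \sum_(j < n.*2.+1) binw R n.*2 j * kraw R j A) * walsh u A.
  rewrite walshB walsh_sphere mulrBl; congr (_ - _).
  rewrite (walsh_lin _ _ (fun j : 'I_(n.*2.+1) => binw R n.*2 j) (fun j => sphere j u)).
  by rewrite mulr_suml; apply: eq_bigr => j _; rewrite walsh_sphere mulrA.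
(* The radii below [M] are exactly those with 64n <= N. *)
pose M := (N %/ 64).+1.
(* By Parseval it suffices to bound the multipliers at each character, where [kraw_binw_sum] applies
   with x = |A| / N <= 1/2. *)
have D_sum : \sum_(n < M) \sum_J D n J ^+ 2 <= 208 * \sum_J u J ^+ 2.
  have p2 : 0 < 2 ^+ N :> R by rewrite exprn_gt0.
  rewrite -(ler_pM2l p2) [leRHS]mulrCA -walsh_parseval mulr_sumr.
  under eq_bigr do rewrite -walsh_parseval.
  rewrite exchange_big mulr_sumr; apply: ler_sum => A _ /=.
  under eq_bigr do rewrite WD exprMn.
  rewrite -mulr_suml.
  case: (leqP (2 * #|A|) N) => hA; last by rewrite ulow // expr0n !mulr0.
  rewrite ler_wpM2r ?sqr_ge0 //.
  have NR : 0 < N%:R :> R by rewrite ltr0n.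
  apply: (@kraw_binw_sum R N (#|A|%:R / N%:R) _ (fun n => kraw R n A) _ _ (erefl _)).
  - by rewrite divr_ge0.
  - by rewrite ler_pdivrMr // ler_pdivlMl // -natrM ler_nat.
  - exact: kraw0.
  - exact: kraw1.
  - by move=> n; exact: kraw_rec.
  - by move=> n; rewrite /M ltnS => h; rewrite mulnC; apply: leq_trans (leq_divM N 64);
    rewrite leq_mul2r h orbT.
have := @binsphere_selection (fun J => (k J).*2) u (fun J => _).
move=> /(_ ltac:(move=> J; have := kN J; lia)) B_sum.
apply: (@le_trans _ _ (\sum_J (2 * binsphere (k J).*2 u J ^+ 2 + 2 * \sum_(n < M) D n J ^+ 2))).
  apply: ler_sum => J _.
  have kM : (k J < M)%N by rewrite /M ltnS leq_divRL // mulnC.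
  have : D (k J) J ^+ 2 <= \sum_(n < M) D n J ^+ 2.
    by rewrite (bigD1 (Ordinal kM)) //= lerDl sumr_ge0 // => i _; exact: sqr_ge0.
  rewrite /D; move: (\sum_(n < M) _) (sphere _ _ _) (binsphere _ _ _) => a b c.
  by have := sqr_ge0 (b - 2 * c); nra.
rewrite big_split /= -!mulr_sumr exchange_big /=.
lra.
Qed.

(** The function splits orthogonally by character weight. Modulation by (-1)^|J| sends a character
    to that of the complement and changes [sphere n] only by signs, so both parts reduce to low
    spectrum; 848 = 2 * 424. *)
Theorem sphere_selection (k : {set T} -> nat) g : (0 < N)%N ->
  (forall J, 64 * k J <= N)%N ->
  \sum_J sphere (k J) g J ^+ 2 <= 848 * \sum_J g J ^+ 2.
Proof.
move=> N0 kN.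
pose proj (P : pred {set T}) J := (2 ^+ N)^-1 * walsh (fun A => (P A)%:R * walsh g A) J.
have N2 : 2 ^+ N != 0 :> R by rewrite expf_neq0 // pnatr_eq0.
have Wproj P A : walsh (proj P) A = (P A)%:R * walsh g A.
  transitivity ((2 ^+ N)^-1 * walsh (walsh (fun A => (P A)%:R * walsh g A)) A).
    by rewrite {1 2}/walsh mulr_sumr; apply: eq_bigr => J _; rewrite mulrA.
  by rewrite walshK mulKf.
pose low := fun A : {set T} => (2 * #|A| <= N)%N.
pose lo := proj low; pose hi := proj (predC low).
have g_split J : g J = lo J + hi J.
  rewrite /lo /hi /proj -mulrDr; apply: (mulfI N2); rewrite mulVKf // -walshK.
  rewrite /walsh -big_split /=; apply: eq_bigr => A _.
  by rewrite -mulrDl -mulrDl; case: (low A); rewrite /= ?addr0 ?add0r mul1r.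
have g_norm : \sum_J lo J ^+ 2 + \sum_J hi J ^+ 2 = \sum_J g J ^+ 2.
  apply: (mulfI N2); rewrite mulrDr -!walsh_parseval -big_split /=; apply: eq_bigr => A _.
  by rewrite !Wproj /=; case: (low A); rewrite /= mul0r mul1r expr0n ?addr0 ?add0r.
pose h J := chi R finset.setT J * hi J.
have hE J : hi J = chi R finset.setT J * h J by rewrite /h mulrA -expr2 chi_sqr mul1r.
have h_low : spectrally_low h.
  move=> A hA.
  transitivity (walsh hi (symd finset.setT A)).
    by apply: eq_bigr => J _; rewrite /h [chi _ (symd _ _) J]chiC chiM !(chiC _ J); ring.
  rewrite /hi Wproj /=.
  suff -> : low (symd finset.setT A) by rewrite mul0r.
  rewrite /low; suff -> : symd finset.setT A = ~: A by have := cardsC A; lia.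
  by apply/setP => x; rewrite in_symd !inE.
have lo_low : spectrally_low lo.
  by move=> A; rewrite ltnNge => /negPf hA; rewrite /lo Wproj /low hA mul0r.
have sphere_hi n J : sphere n hi J ^+ 2 = sphere n h J ^+ 2.
  suff -> : sphere n hi J = (-1) ^+ n * chi R finset.setT J * sphere n h J.
    by rewrite !exprMn chi_sqr -exprM mulnC exprM sqrrN !expr1n !mul1r.
  rewrite /sphere [RHS]mulrCA [X in _ = _ * X]mulr_sumr; congr (_ * _);
    apply: eq_bigr => I /eqP <-.
  by rewrite hE chiM (chiT _ I); ring.
have h_norm : \sum_J h J ^+ 2 = \sum_J hi J ^+ 2.
  by apply: eq_bigr => J _; rewrite exprMn chi_sqr mul1r.
have L1 := sphere_low_selection N0 kN lo_low.
have L2 := sphere_low_selection N0 kN h_low.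
apply: (@le_trans _ _ (\sum_J (2 * sphere (k J) lo J ^+ 2 + 2 * sphere (k J) h J ^+ 2))).
  apply: ler_sum => J _; rewrite -sphere_hi.
  have -> : sphere (k J) g J = sphere (k J) lo J + sphere (k J) hi J.
    by rewrite /sphere -mulrDr -big_split /=; congr (_ * _); apply: eq_bigr => I _;
      exact: g_split.
  move: (sphere _ lo _) (sphere _ hi _) => a b.
  by have := sqr_ge0 (a - b); nra.
rewrite big_split /= -!mulr_sumr; lra.
Qed.

End cube_maximal.

Local Open Scope classical_set_scope.
Local Open Scope ring_scope.

(** * Transference to the lattice *)

Section lattice_sum.
Variables (R : realType) (d : nat).
Local Notation X := (lattice d).
Implicit Types h f : X -> R.

Definition lsum h : \bar R := (\int[counting]_x (h x)%:E)%E.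

Lemma lsum_ge0 h : (forall x, 0 <= h x) -> (0 <= lsum h)%E.
Proof. by move=> h0; apply: integral_ge0 => x _; rewrite lee_fin. Qed.

Lemma ler_lsum h1 h2 : (forall x, 0 <= h1 x <= h2 x) -> (lsum h1 <= lsum h2)%E.
Proof.
move=> h12; apply: ge0_le_integral => //.
- by move=> x _; rewrite lee_fin; case/andP: (h12 x).
- by move=> x _; rewrite lee_fin; case/andP: (h12 x).
Qed.

Lemma lsum_sum (I : Type) (r : seq I) (h : I -> X -> R) :
  (forall i x, 0 <= h i x) ->
  lsum (fun x => \sum_(i <- r) h i x) = (\sum_(i <- r) lsum (h i))%E.
Proof.
move=> h0; rewrite /lsum -ge0_integral_sum //.
- by apply: eq_integral => x _; rewrite sumEFin.
- by move=> i x _; rewrite lee_fin.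
Qed.

Lemma lsumZ (c : R) h : 0 <= c -> (forall x, 0 <= h x) ->
  lsum (fun x => c * h x) = (c%:E * lsum h)%E.
Proof.
move=> c0 h0; rewrite /lsum -ge0_integralZl_EFin //.
by move=> x _; rewrite lee_fin.
Qed.

Lemma lsum_bij (phi psi : X -> X) h : cancel phi psi -> cancel psi phi ->
  (forall x, 0 <= h x) -> lsum (h \o phi) = lsum h.
Proof.
move=> K1 K2 h0.
have mphi : measurable_fun setT phi by [].
transitivity (\int[pushforward (@counting X R) phi]_x (h x)%:E)%E.
  by rewrite (@ge0_integral_pushforward _ _ X X R phi mphi counting setT (EFin \o h)) // => x
    _; rewrite /= lee_fin.
apply: eq_measure_integral => A _ _.
have E : phi @^-1` A = psi @` A.
  apply/seteqP; split=> [x Ax|_ [x Ax <-]]; first by exists (phi x); rewrite ?K1.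
  by rewrite /preimage /= K2.
have inj : {in A &, injective psi} by move=> x y _ _; exact: (can_inj K2).
have fin_eq : finite_set (psi @` A) = finite_set A.
  by rewrite propeqE; split; rewrite (eq_finite_set (inj_card_eq inj)).
rewrite -[LHS]/(counting (phi @^-1` A)) -[RHS]/(counting A) E /counting fin_eq;
  case: asboolP => // fA.
by rewrite fset_set_image // card_imfset //; exact: (can_inj K2).
Qed.

End lattice_sum.

Lemma sume_const (R : realType) (I : finType) (x : \bar R) : (0 <= x)%E ->
  (\sum_(i : I) x = #|I|%:R%:E * x)%E.
Proof.
move=> x0; rewrite big_const; elim: #|I| => [|n IH]; first by rewrite mul0e.
by rewrite iterS IH -natr1 EFinD ge0_muleDl ?lee_fin // mul1e addeC.
Qed.

Section spherical_maximal.
Variables (R : realType) (T : finType).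
Implicit Types (I J : {set T}) (g : {set T} -> R).

Definition max_sphere g J : R :=
  \big[Num.max/0]_(n < #|T|.+1 | (64 * n <= #|T|)%N) sphere n g J.

Lemma sphere_ge0 n g J : (forall I, 0 <= g I) -> 0 <= sphere n g J.
Proof. by move=> g0; rewrite mulr_ge0 ?invr_ge0 // sumr_ge0. Qed.

Lemma max_sphere_ge0 g J : 0 <= max_sphere g J.
Proof. exact: bigmax_ge_id. Qed.

Lemma le_max_sphere n g J : (64 * n <= #|T|)%N -> sphere n g J <= max_sphere g J.
Proof.
move=> nT; have nT' : (n < #|T|.+1)%N by lia.
exact: (@le_bigmax_cond _ _ 'I_(#|T|.+1) 0 (Ordinal nT') _ (fun n : 'I_(#|T|.+1) => sphere n g
  J)).
Qed.

Lemma ler_max_sphere f g J : (forall I, f I <= g I) -> max_sphere f J <= max_sphere g J.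
Proof.
move=> fg; apply: le_bigmax2 => n _.
by rewrite ler_wpM2l ?invr_ge0 // ler_sum.
Qed.

(** A maximising radius is selected at each [J]. Radius 0 is always allowed and the means are
    nonnegative, so the default 0 of the maximum does not interfere. *)
Lemma max_sphere_bound g : (0 < #|T|)%N -> (forall I, 0 <= g I) ->
  \sum_J max_sphere g J ^+ 2 <= 848 * \sum_J g J ^+ 2.
Proof.
move=> T0 g0.
pose k J := [arg max_(n > (ord0 : 'I_(#|T|.+1)) | (64 * n <= #|T|)%N) sphere n g J]%O.
have kE J : max_sphere g J = sphere (k J) g J.
  by rewrite /max_sphere (bigmax_eq_arg _ ord0) //= ?muln0 // => n _; exact: sphere_ge0.
have kN J : (64 * k J <= #|T|)%N.
  by rewrite /k; case: arg_maxP; rewrite ?muln0.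
under eq_bigr do rewrite kE.
exact: (sphere_selection (k := fun J => k J)).
Qed.

End spherical_maximal.

Section transference.
Variables (R : realType) (d : nat) (T : finType).
Local Notation X := (lattice d).
Variable Phi : {set T} -> X -> X.
Hypothesis Phi0 : forall x, Phi finset.set0 x = x.
Hypothesis PhiM : forall I J x, Phi I (Phi J x) = Phi (symd I J) x.
Variable C : R.
Hypotheses (C_ge0 : 0 <= C) (cube_bound : forall g : {set T} -> R, (forall I, 0 <= g I) ->
  \sum_J max_sphere g J ^+ 2 <= C * \sum_J g J ^+ 2).
Implicit Types f g : X -> R.

Definition orbit_max f x : R := max_sphere (fun I => f (Phi I x)) finset.set0.

Lemma orbit_max_ge0 f x : 0 <= orbit_max f x.
Proof. exact: max_sphere_ge0. Qed.

Lemma ler_orbit_max f g x : (forall x, f x <= g x) -> orbit_max f x <= orbit_max g x.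
Proof. by move=> fg; exact: ler_max_sphere. Qed.

Lemma orbit_maxE f x J : orbit_max f (Phi J x) = max_sphere (fun I => f (Phi I x)) J.
Proof.
apply: eq_bigr => n _; congr (_ * _); apply: eq_bigr => I _.
by rewrite PhiM symd0s symdC.
Qed.

(** Lattice sums are invariant under every [Phi J], so both sides may be averaged over [J]. For
    fixed [x] the values of [f] along the orbit form a function on the cube, to which [cube_bound]
    applies whether or not the orbit map is injective. *)
Lemma orbit_max_bound f : (forall x, 0 <= f x) ->
  (lsum (fun x => orbit_max f x ^+ 2)%R <= C%:E * lsum (fun x => f x ^+ 2)%R)%E.
Proof.
move=> f0.
have PhiK J : cancel (Phi J) (Phi J) by move=> x; rewrite PhiM symdd Phi0.
pose c : R := (2 ^+ #|T|)^-1.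
have c0 : 0 <= c by rewrite invr_ge0 exprn_ge0.
have avg h : (forall x, 0 <= h x) -> lsum h = lsum (fun x => c * \sum_(J : {set T}) h (Phi J x)).
  move=> h0; rewrite lsumZ //; last by move=> x; exact: sumr_ge0.
  rewrite lsum_sum // (eq_bigr (fun=> lsum h)) => [|J _];
    last exact: (lsum_bij (PhiK J) (PhiK J)).
  rewrite sume_const ?lsum_ge0 // muleA -EFinM card_subsets natrX mulVf ?mul1e //.
rewrite avg; last by move=> x; exact: sqr_ge0.
rewrite [X in (_ <= _ * X)%E]avg; last by move=> x; exact: sqr_ge0.
have avg0 x : 0 <= c * \sum_(J : {set T}) f (Phi J x) ^+ 2.
  by rewrite mulr_ge0 // sumr_ge0 // => J _; exact: sqr_ge0.
have <- := lsumZ C_ge0 avg0.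
apply: ler_lsum => x; apply/andP; split.
  by rewrite mulr_ge0 // sumr_ge0 // => J _; exact: sqr_ge0.
rewrite mulrCA; apply: ler_wpM2l => //.
under eq_bigr do rewrite orbit_maxE.
exact: cube_bound.
Qed.

End transference.

(** * Involutions replacing translations, and their action on the lattice *)

Section flip.
Implicit Types (m : nat) (b : bool) (z : int).

(** Colours the intervals of length [m] starting at multiples of [m] alternately, so that a step by
    m or -m changes the colour. *)
Definition par m z : bool := odd `|(z %/ m%:Z)%Z|%N.

Lemma odd_absD1 (q : int) : odd `|(q + 1)%R|%N = ~~ odd `|q|%N.
Proof.
case: q => n; first by rewrite -[1]/(Posz 1) -PoszD !absz_nat addn1.
have -> : Negz n + 1 = - n%:Z by rewrite NegzE -addn1 PoszD opprD subrK.
by rewrite abszN absz_nat /= negbK.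
Qed.

Lemma par_step m b z : (0 < m)%N -> par m (z + (-1) ^+ b * m%:Z) = ~~ par m z.
Proof.
move=> m0; have m0' : m%:Z != 0 by rewrite eqz_nat -lt0n.
rewrite /par addrC divzMDl // addrC; case: b => /=; last by rewrite expr0 odd_absD1.
by rewrite expr1; set q := (_ %/ _)%Z; rewrite -[in RHS](subrK 1 q) odd_absD1 negbK.
Qed.

(* The translations of Z by m and by -m average to the mean over b of the
   involutions [flip m b], each of which swaps the two members of every pair
   of a partition of Z into pairs at distance m. *)
Definition flip m b z : int := z - (-1) ^+ (par m z (+) b) * m%:Z.

Lemma flipK m b : (0 < m)%N -> involutive (flip m b).
Proof.
move=> m0 z; rewrite /flip.
have step (c : bool) : z - (-1) ^+ c * m%:Z = z + (-1) ^+ (~~ c) * m%:Z by rewrite signrN mulNr.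
by rewrite step par_step // addNb addrK.
Qed.
End flip.

Lemma imset_symd (T U : finType) (f : T -> U) (A B : {set T}) : injective f ->
  f @: symd A B = symd (f @: A) (f @: B).
Proof.
move=> fi; apply/setP => u; rewrite in_symd.
have [[x ->]|h] := pselect (exists x, u = f x); first by rewrite !mem_imset // in_symd.
have no (C : {set T}) : (u \in f @: C) = false.
  by apply/negbTE/imsetP => -[x _ ux]; apply: h; exists x.
by rewrite !no.
Qed.

(** Equal counts of each positive value force equal counts of 0, the total being [d]; the two lists
    of values are then rearrangements of each other. *)
Lemma matching_perm d L (f g : 'I_d -> nat) :
  (forall c, f c <= L)%N -> (forall c, g c <= L)%N ->
  (forall i : 'I_L, #|[set c | f c == i.+1]%SET| = #|[set c | g c == i.+1]%SET|) ->
  exists t : 'S_d, forall c, f c = g (t c).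
Proof.
move=> fL gL fg.
pose tf := [tuple f c | c < d]; pose tg := [tuple g c | c < d].
have cntE (h : 'I_d -> nat) v : count_mem v [tuple h c | c < d] = #|[set c | h c == v]%SET|.
  by rewrite count_map -sum1_count -sum1dep_card /= big_enum_cond.
have nz (h : 'I_d -> nat) : (forall c, h c <= L)%N ->
    #|[set c | h c == 0]%SET| = (d - \sum_(i < L) #|[set c | h c == i.+1]%SET|)%N.
  move=> hL.
  have -> : (\sum_(i < L) #|[set c | h c == i.+1]%SET|)%N = #|[set c | h c != 0]%SET|.
    under eq_bigr do rewrite -sum1dep_card big_mkcond.
    rewrite exchange_big -sum1dep_card [RHS]big_mkcond /=; apply: eq_bigr => c _.
    case: (h c) (hL c) => [|v] vL; first by rewrite big1.
    rewrite (bigD1 (Ordinal vL)) //= eqxx big1 ?addn0 // => i iv.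
    by rewrite eqSS; case: eqP => // vi; case/eqP: iv; exact: val_inj.
  have := cardsC [set c | h c == 0]%SET; rewrite card_ord.
  suff -> : ~: [set c | h c == 0]%SET = [set c | h c != 0]%SET by lia.
  by apply/setP => c; rewrite !inE.
have large (h : 'I_d -> nat) v : (forall c, h c <= L)%N -> (L <= v)%N ->
    #|[set c | h c == v.+1]%SET| = 0%N.
  move=> hL Lv; apply/eqP; rewrite cards_eq0; apply/eqP/setP => c; rewrite !inE.
  by apply/eqP => hc; have := hL c; rewrite hc ltnNge Lv.
have /tuple_permP[t tE] : perm_eq tf tg.
  apply/allP => v _ /=; rewrite !cntE; case: v => [|v].
    by rewrite !nz // (eq_bigr _ (fun i _ => fg i)).
  case: (ltnP v L) => vL; first by rewrite (fg (Ordinal vL)).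
  by rewrite !large.
exists t => c; have := congr1 (fun s => nth 0%N s c) tE.
by rewrite -!tnth_nth !tnth_mktuple.
Qed.

Section action.
Variables (R : realType) (d : nat).
Local Notation X := (lattice d).
Implicit Types (x y : X) (f : X -> R) (J : {set 'I_d}) (a : {ffun 'I_d -> bool}).

Definition crd x c : int := (x : 'rV[int]_d) ord0 c.

Lemma crd_eq x y : (forall c, crd x c = crd y c) -> x = y.
Proof. by move=> xy; apply/rowP => c; exact: xy. Qed.

Lemma crdB x y c : crd (x - y) c = crd x c - crd y c.
Proof. by rewrite /crd !mxE. Qed.

Definition signs a (v : 'I_d -> int) : X := \row_c ((-1) ^+ a c * v c).

Lemma crd_signs a v c : crd (signs a v) c = (-1) ^+ a c * v c.
Proof. by rewrite /crd mxE. Qed.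

Definition act (m : 'I_d -> nat) a J x : X :=
  \row_c (if c \in J then flip (m c) (a c) (crd x c) else crd x c).

Lemma crd_act m a J x c :
  crd (act m a J x) c = if c \in J then flip (m c) (a c) (crd x c) else crd x c.
Proof. by rewrite /crd mxE. Qed.

Lemma sum_xor f (b : 'I_d -> bool) (F : {ffun 'I_d -> bool} -> X) :
  \sum_(a : {ffun 'I_d -> bool}) f (F [ffun c => b c (+) a c]) = \sum_(a : {ffun 'I_d -> bool})
    f (F a).
Proof.
rewrite [RHS](reindex_inj (h := fun a : {ffun 'I_d -> bool} => [ffun c => b c (+) a c])) //.
apply: inv_inj => a; apply/ffunP => c; rewrite !ffunE addbA addbb //.
Qed.

(** For fixed [x] the parities only shift the sign vector [a], which does not affect the sum over
    all [a]. *)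
Lemma sum_act m J x f :
  \sum_(a : {ffun 'I_d -> bool}) f (act m a J x) =
  \sum_(a : {ffun 'I_d -> bool}) f (x - signs a (fun c => if c \in J then (m c)%:Z else 0)).
Proof.
rewrite -(sum_xor f (fun c => par (m c) (crd x c))
  (fun a => x - signs a (fun c => if c \in J then (m c)%:Z else 0))).
apply: eq_bigr => a _; congr f; apply: crd_eq => c.
rewrite crdB crd_act crd_signs ffunE /flip; case: ifP => // _.
by rewrite mulr0 subr0.
Qed.

Lemma sum_signs_abs f x (v : 'I_d -> int) :
  \sum_(a : {ffun 'I_d -> bool}) f (x - signs a v) = \sum_(a : {ffun 'I_d -> bool}) f (x -
    signs a (fun c => `|v c|%N%:Z)).
Proof.
rewrite -(sum_xor f (fun c => v c < 0) (fun a => x - signs a (fun c => `|v c|%N%:Z))).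
apply: eq_bigr => a _; congr f; apply: crd_eq => c.
rewrite !crdB !crd_signs ffunE {1}(intEsign (v c)) mulrA; congr (_ - _ * _).
by rewrite addbC signr_addb.
Qed.

Lemma actM m a I J x : (forall c, 0 < m c)%N ->
  act m a I (act m a J x) = act m a (symd I J) x.
Proof.
move=> m0; apply: crd_eq => c; rewrite !crd_act in_symd.
by case: (c \in I); case: (c \in J); rewrite //= flipK.
Qed.

Lemma act0 m a x : act m a finset.set0 x = x.
Proof. by apply: crd_eq => c; rewrite crd_act inE. Qed.

End action.

(** * Random splitting of the coordinates into blocks *)

Section blocks.
Variables (R : realType) (d L N : nat).
Hypotheses (LNd : (L * N <= d)%N) (N0 : (0 < N)%N).
Local Notation X := (lattice d).
Local Notation Omega := ({perm 'I_d} * {ffun 'I_d -> bool})%type.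
Implicit Types (x y : X) (f g : X -> R) (J : {set 'I_d}) (w : Omega) (s : seq 'I_L).

Lemma block_subproof (i : 'I_L) (j : 'I_N) : (i * N + j < d)%N.
Proof.
apply: leq_trans LNd; apply: (@leq_trans (i.+1 * N)); last by rewrite leq_mul2r ltn_ord orbT.
by rewrite mulSn addnC ltn_add2r.
Qed.

Definition block i j : 'I_d := Ordinal (block_subproof i j).

Lemma block_inj i : injective (block i).
Proof. by move=> j k /(congr1 val) /= /addnI h; exact: val_inj. Qed.

Lemma block_divn i j : (block i j %/ N)%N = i.
Proof. by rewrite /= divnMDl // divn_small // addn0. Qed.

(* For w = (s, a), s relabels the coordinates and a selects the pairings of Z;
   the coordinates of the i-th block (counted from 0) move by i + 1. *)
Definition twist w J x : X :=
  act (fun c => ((w.1^-1)%g c %/ N).+1) w.2 (w.1 @: J) x.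

Lemma twist0 w x : twist w finset.set0 x = x.
Proof. by rewrite /twist imset0 act0. Qed.

Lemma twistM w I J x : twist w I (twist w J x) = twist w (symd I J) x.
Proof. by rewrite /twist actM // imset_symd //; exact: perm_inj. Qed.

Definition block_act w i (I : {set 'I_N}) x : X := twist w (block i @: I) x.

Lemma block_act0 w i x : block_act w i finset.set0 x = x.
Proof. by rewrite /block_act imset0 twist0. Qed.

Lemma block_actM w i (I J : {set 'I_N}) x : block_act w i I (block_act w i J x) = block_act w i
  (symd I J) x.
Proof. by rewrite /block_act twistM imset_symd //; exact: block_inj. Qed.

Fixpoint iter_max w s f : X -> R :=
  if s is i :: s' then orbit_max (block_act w i) (iter_max w s' f) else f.

Lemma iter_max_ge0 w s f : (forall x, 0 <= f x) -> forall x, 0 <= iter_max w s f x.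
Proof. by case: s => [//|i s] f0 x; exact: orbit_max_ge0. Qed.

Fixpoint iter_sphere w (r : 'I_L -> nat) s f : X -> R :=
  if s is i :: s' then
    fun x => sphere (r i) (fun I => iter_sphere w r s' f (block_act w i I x)) finset.set0
  else f.

(** Spherical means are monotone on nonnegative functions, so each one may in turn be replaced by
    its maximal operator. *)
Lemma iter_sphere_le w r s f : (forall i, 64 * r i <= N)%N -> (forall x, 0 <= f x) ->
  forall x, 0 <= iter_sphere w r s f x <= iter_max w s f x.
Proof.
move=> rN f0; elim: s => [|i s IH] x /=; first by rewrite f0 lexx.
apply/andP; split.
  by apply: sphere_ge0 => I; case/andP: (IH (block_act w i I x)).
apply: (@le_trans _ _ (orbit_max (block_act w i) (iter_sphere w r s f) x)).
  by apply: le_max_sphere; rewrite card_ord.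
by apply: ler_orbit_max => z; case/andP: (IH z).
Qed.

Definition block_count J (i : nat) := #|[set c in J | (c %/ N)%N == i]%SET|.

Definition profile (r : 'I_L -> nat) s J :=
  (forall i : 'I_L, block_count J i = if i \in s then r i else 0%N) /\
  (forall c, c \in J -> (c %/ N < L)%N).

(* The weights do not depend on w, so that averaging over w can be done first. *)
Lemma iter_sphere_weights r s : uniq s -> (forall i, r i <= N)%N ->
  exists W : {set 'I_d} -> R, [/\ \sum_J W J = 1,
    forall J, W J != 0 -> profile r s J &
    forall w f x, iter_sphere w r s f x = \sum_J W J * f (twist w J x)].
Proof.
move=> + rN; elim: s => [|i s IH] => [_|/= /andP[i_s /IH[W [W1 Wsupp WE]]]].
  exists (fun J => (J == finset.set0)%:R); split.
  - rewrite (bigD1 finset.set0) //= eqxx big1 ?addr0 // => J J0.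
    by rewrite (negPf J0).
  - move=> J; case: (eqVneq J finset.set0) => [-> _|_]; last by rewrite eqxx.
    split=> [i|c]; last by rewrite inE.
    by rewrite in_nil; apply/eqP; rewrite cards_eq0; apply/eqP/setP => c; rewrite !inE.
  - move=> w f x /=; rewrite (bigD1 finset.set0) //= eqxx mul1r twist0 big1 ?addr0 //.
    by move=> J /negPf ->; rewrite mul0r.
pose K : R := 'C(N, r i)%:R^-1.
have K1 : K * \sum_(I : {set 'I_N} | #|I| == r i) 1 = 1.
  have E : \sum_(I : {set 'I_N} | #|I| == r i) (1 : R) = 'C(N, r i)%:R.
    rewrite sumr_const; have := card_draws 'I_N (r i); rewrite card_ord => <-.
    by congr (_%:R); rewrite -[LHS]cardsE; apply: eq_card => I; rewrite !inE.
  by rewrite E mulVf // pnatr_eq0 -lt0n bin_gt0.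
(* The new weights are the convolution of [W] with the uniform law on the [r i]-subsets of block
   [i]. *)
exists (fun J => K * \sum_(I : {set 'I_N} | #|I| == r i) W (symd J (block i @: I))); split.
- rewrite -mulr_sumr exchange_big -[RHS]K1; congr (_ * _); apply: eq_bigr => I _ /=.
  by under eq_bigr do rewrite symdC; rewrite sum_symd.
- move=> J; rewrite mulf_eq0 negb_or => /andP[_ S0].
  have [I /eqP Ir WI] : exists2 I : {set 'I_N}, #|I| == r i & W (symd J (block i @: I)) != 0.
    apply/exists_inP; apply: contraNT S0 => /exists_inPn h.
    by apply/eqP/big1 => I hI; apply/eqP; rewrite -[_ == _]negbK h.
  have [cnt lt] := Wsupp _ WI; set J' := symd J (block i @: I) in cnt lt.
  have JE : J = symd J' (block i @: I) by rewrite /J' -symdA symdd symds0.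
  clearbody J'.
  have notI c : c \in block i @: I -> (c %/ N)%N = i.
    by case/imsetP => j _ ->; rewrite block_divn.
  (* As [i] is not in [s], the set [J'] misses block [i]; the symmetric difference is therefore a
     disjoint union. *)
  have J'i c : c \in J' -> (c %/ N)%N != i.
    move=> cJ'; apply/eqP => ci; have := cnt i; rewrite (negPf i_s) => /eqP.
    by rewrite cards_eq0 => /eqP/setP/(_ c); rewrite !inE cJ' ci eqxx.
  split=> [k|c]; last first.
    rewrite JE in_symd; case cJ': (c \in J') => /=; first by rewrite lt.
    by move/notI ->.
  rewrite in_cons; case: eqVneq => [->|ki] /=.
    rewrite -Ir -(card_imset _ (@block_inj i)); apply: eq_card => c; rewrite !inE JE in_symd.
    have := notI c; have := J'i c; case: (c \in J'); case: (c \in block i @: I) => //=.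
    + by move=> /(_ isT) /eqP h1 /(_ isT) h2.
    + by move=> /(_ isT) /negPf ->.
    + by move=> _ /(_ isT) ->; rewrite eqxx.
  rewrite -cnt; apply: eq_card => c; rewrite !inE JE in_symd.
  have := notI c; case: (c \in block i @: I); rewrite ?addbF // => /(_ isT) ->.
  by rewrite val_eqE eq_sym (negPf ki) !andbF.
- move=> w f x /=; rewrite /sphere card_ord -/K.
  under [RHS]eq_bigr do rewrite -mulrA mulr_suml.
  rewrite -mulr_sumr exchange_big /=; congr (_ * _); apply: eq_bigr => I _.
  rewrite WE -[RHS](sum_symd (block i @: I)); apply: eq_bigr => J _.
  rewrite symd0s /block_act twistM; congr (W _ * f _).
    by rewrite symdC symdA symdd symd0s.
  by rewrite symdC.
Qed.

Definition Omega_avg (F : Omega -> R) : R := #|{: Omega}|%:R^-1 * \sum_w F w.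

Definition orbit_avg f x y : R :=
  Omega_avg (fun w => f (x - signs w.2 (fun c => crd y (w.1 c)))).

Definition strong_max f x : R := Omega_avg (fun w => iter_max w (enum 'I_L) f x).

Lemma Omega_card_gt0 : 0 < #|{: Omega}|%:R :> R.
Proof. by rewrite ltr0n; apply/card_gt0P; exists (1%g, [ffun=> true]). Qed.

Lemma Omega_avg_cst (c : R) : Omega_avg (fun=> c) = c.
Proof.
rewrite /Omega_avg sumr_const -[X in _ * X]mulr_natl mulrA mulVf ?mul1r //.
by rewrite lt0r_neq0 // Omega_card_gt0.
Qed.

Lemma Omega_sum (F : Omega -> R) :
  \sum_w F w = \sum_(p : {perm 'I_d}) \sum_(a : {ffun 'I_d -> bool}) F (p, a).
Proof. by rewrite pair_bigA; apply: eq_bigr => -[]. Qed.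

(** The set [J] encodes a vector with entry i + 1 at its points in block [i], having as many entries
    of each size as |y|. A permutation matching the two is absorbed by the mean over permutations,
    and the signs by the mean over [a]. *)
Lemma orbit_avg_twist f x y J (r : 'I_L -> nat) : (forall c, `|crd y c| <= L)%N ->
  (forall i : 'I_L, r i = #|[set c | `|crd y c| == i.+1]%N%SET|) ->
  profile r (enum 'I_L) J ->
  Omega_avg (fun w => f (twist w J x)) = orbit_avg f x y.
Proof.
move=> yL rE [cnt lt].
pose z c := if c \in J then (c %/ N).+1 else 0%N.
have [c|c|i|t tE] := @matching_perm d L (fun c => `|crd y c|%N) z.
- exact: yL.
- by rewrite /z; case: ifP => // cJ; exact: lt.
- rewrite -rE; have := cnt i; rewrite mem_enum inE => <-.
  by apply: eq_card => c; rewrite !inE /z; case: (c \in J).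
rewrite /orbit_avg /Omega_avg; congr (_ * _).
rewrite !Omega_sum /=.
have -> : \sum_(p : {perm 'I_d}) \sum_(a : {ffun 'I_d -> bool}) f (twist (p, a) J x) =
    \sum_(p : {perm 'I_d}) \sum_(a : {ffun 'I_d -> bool}) f (x - signs a (fun c => (z (p c))%:Z)).
  rewrite [RHS](reindex_inj invg_inj) /=; apply: eq_bigr => p _.
  rewrite /twist /= sum_act; apply: eq_bigr => a _; congr (f (x - signs a _)); apply: funext => c.
  rewrite /z; have -> : (c \in p @: J) = (p^-1%g c \in J).
    by rewrite -{1}(permKV p c) mem_imset //; exact: perm_inj.
  by case: ifP.
rewrite [LHS](reindex_inj (mulIg t)) /=; apply: eq_bigr => p _.
rewrite [RHS]sum_signs_abs; apply: eq_bigr => a _; congr (f (x - signs a _)); apply: funext => c.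
by rewrite permM -tE.
Qed.

(** All sets [J] in the support of the weights give the same mean over [w], namely
    [orbit_avg f x y]. This is thus the mean over [w] of iterated spherical means, which the
    iterated maximal functions dominate. *)
Lemma orbit_avg_le f x y : (forall x, 0 <= f x) -> (forall c, `|crd y c| <= L)%N ->
  (forall i : 'I_L, 64 * #|[set c | `|crd y c| == i.+1]%N%SET| <= N)%N ->
  orbit_avg f x y <= strong_max f x.
Proof.
move=> f0 yL yN.
pose r (i : 'I_L) := #|[set c | `|crd y c| == i.+1]%N%SET|.
have [||W [W1 Wsupp WE]] := @iter_sphere_weights r (enum 'I_L); first exact: enum_uniq.
  by move=> i; have := yN i; rewrite /r; lia.
have -> : orbit_avg f x y = Omega_avg (fun w => iter_sphere w r (enum 'I_L) f x).
  rewrite /Omega_avg; under eq_bigr do rewrite WE.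
  transitivity (\sum_J W J * orbit_avg f x y); first by rewrite -mulr_suml W1 mul1r.
  rewrite exchange_big /= mulr_sumr; apply: eq_bigr => J _.
  rewrite -mulr_sumr [RHS]mulrCA; have [->|WJ] := eqVneq (W J) 0; first by rewrite !mul0r.
  by congr (_ * _); rewrite -(@orbit_avg_twist f x y J r) //; exact: Wsupp.
rewrite /strong_max /Omega_avg ler_wpM2l ?invr_ge0 // ler_sum // => w _.
by case/andP: (@iter_sphere_le w r (enum 'I_L) f yN f0 x).
Qed.

Lemma strong_max_ge0 f x : (forall x, 0 <= f x) -> 0 <= strong_max f x.
Proof. by move=> f0; rewrite mulr_ge0 ?invr_ge0 // sumr_ge0 // => w _; exact: iter_max_ge0. Qed.

Variable C : R.
Hypotheses (C_ge0 : 0 <= C) (cube_bound : forall g : {set 'I_N} -> R, (forall I, 0 <= g I) ->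
  \sum_J max_sphere g J ^+ 2 <= C * \sum_J g J ^+ 2).

Lemma iter_max_bound w s f : (forall x, 0 <= f x) ->
  (lsum (fun x => iter_max w s f x ^+ 2)%R <= (C ^+ size s)%:E * lsum (fun x => f x ^+ 2)%R)%E.
Proof.
move=> f0; elim: s => [|i s IH]; first by rewrite expr0 mul1e.
apply: (le_trans (@orbit_max_bound R d 'I_N (block_act w i) (@block_act0 w i) (@block_actM w i)
  C C_ge0 cube_bound _ (iter_max_ge0 w s f0))).
rewrite exprS EFinM -muleA; apply: lee_wpmul2l; last exact: IH.
by rewrite lee_fin.
Qed.

(** For each [w] the [L] block operators cost one factor [C] apiece; convexity of the square
    preserves the bound in the mean over [w]. *)
Lemma strong_max_bound f : (forall x, 0 <= f x) ->
  (lsum (fun x => strong_max f x ^+ 2)%R <= (C ^+ L)%:E * lsum (fun x => f x ^+ 2)%R)%E.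
Proof.
move=> f0; pose c : R := #|{: Omega}|%:R^-1.
have c0 : 0 <= c by rewrite invr_ge0.
have sq0 w x : 0 <= iter_max w (enum 'I_L) f x ^+ 2 by exact: sqr_ge0.
apply: (@le_trans _ _ (lsum (fun x => c * \sum_w iter_max w (enum 'I_L) f x ^+ 2))).
  apply: ler_lsum => x; rewrite sqr_ge0 /= /strong_max /Omega_avg -/c.
  rewrite [in leRHS]mulr_sumr mulr_sumr.
  apply: (le_trans (sum_sqr_le _ _ (fun _ _ => c0))).
  have -> : \sum_(w : Omega) c = 1 by have := Omega_avg_cst 1;
    rewrite /Omega_avg mulr_sumr => <-; apply: eq_bigr => w _; rewrite mulr1.
  by rewrite mul1r.
rewrite lsumZ //; last by move=> x; exact: sumr_ge0.
rewrite lsum_sum //.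
have M0 : (0 <= (C ^+ L)%:E * lsum (fun x => f x ^+ 2)%R)%E.
  by rewrite mule_ge0 // ?lee_fin ?exprn_ge0 // lsum_ge0 // => x; exact: sqr_ge0.
apply: (@le_trans _ _ (c%:E * \sum_(w : Omega) ((C ^+ L)%:E * lsum (fun x => f x ^+ 2)%R))%E).
  apply: lee_wpmul2l; first by rewrite lee_fin.
  apply: lee_sum => w _; have := iter_max_bound w (enum 'I_L) f0.
  by rewrite size_enum_ord.
rewrite sume_const // muleA -EFinM /c mulVf ?mul1e //.
by rewrite lt0r_neq0 // Omega_card_gt0.
Qed.

End blocks.

(** * Lattice points of 1-symmetric bodies *)

Lemma leq_count_inj (T : eqType) (s : seq T) (P Q : pred T) (h : T -> T) :
  uniq s -> (forall y, y \in s -> P y -> (h y \in s) && Q (h y)) ->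
  {in P &, injective h} -> (count P s <= count Q s)%N.
Proof.
move=> us hPQ inj; rewrite -!size_filter -(size_map h); apply: uniq_leq_size.
  rewrite map_inj_in_uniq ?filter_uniq // => x y.
  by rewrite !mem_filter => /andP[Px _] /andP[Py _]; exact: inj.
move=> z /mapP[y + ->]; rewrite mem_filter => /andP[Py ys].
by rewrite mem_filter andbC; exact: hPQ.
Qed.

Section unit_moves.
Variable d : nat.
Local Notation X := (lattice d).
Implicit Types (x y : X) (i j : 'I_d) (s : seq X).

Definition unit_move i j (b : bool) y : X :=
  \row_c (if c == i then crd y i - sgz (crd y i)
          else if c == j then (-1) ^+ b else crd y c).

Lemma crd_unit_move i j b y c : crd (unit_move i j b y) c =
  if c == i then crd y i - sgz (crd y i) else if c == j then (-1) ^+ b else crd y c.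
Proof. by rewrite {1}/crd mxE. Qed.

Definition move_closed s := forall y i j b, y \in s -> i != j ->
  crd y i != 0 -> crd y j = 0 -> unit_move i j b y \in s.

Definition supp y := #|[set c | crd y c != 0]%SET|.

Definition big_entries m s : nat := (\sum_(i < d) count (fun y => m <= `|crd y i|)%N s)%N.

(** The moved entry keeps its sign because m > 0, so the original entry can be recovered and the
    move is injective. *)
Lemma count_unit_move m i j (b : bool) s : uniq s -> move_closed s -> (0 < m)%N ->
  (count (fun y => (m < `|crd y i|) && (crd y j == 0%R))%N s <=
   count (fun y => (m <= `|crd y i|) && (crd y j == (-1) ^+ b)%R)%N s)%N.
Proof.
move=> us ms m0; case: (eqVneq i j) => [->|ij].
  rewrite (eq_count (a2 := pred0)) ?count_pred0 // => y /=.
  by case: eqVneq => [->|]; rewrite ?andbF // absz0 ltn0.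
apply: (@leq_count_inj X s _ _ (unit_move i j b)) => // [y ys /andP[yi /eqP yj]|].
  rewrite ms //; last by rewrite -absz_eq0 -lt0n (leq_ltn_trans _ yi).
  rewrite !crd_unit_move eqxx (eq_sym j i) (negPf ij) !eqxx andbT andTb.
  by move: yi; case: (sgzP (crd y i)); lia.
move=> y z /andP[yi /eqP yj] /andP[zi /eqP zj] e; apply: crd_eq => c.
have := congr1 (fun v => crd v c) e; rewrite !crd_unit_move.
case: (eqVneq c i) => [->|ci].
  by move: yi zi; case: (sgzP (crd y i)); case: (sgzP (crd z i)); lia.
by case: (eqVneq c j) => [->|//]; rewrite yj zj.
Qed.

(* Double counting of the moves (y, i, j, b): at least d - K choices of j lead
   away from y, at most K choices lead to a given point, and i, j, b and the
   target determine y. *)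
Lemma big_entries_step m K s : uniq s -> move_closed s -> (0 < m)%N ->
  (forall y, y \in s -> supp y <= K)%N ->
  (2 * (d - K) * big_entries m.+1 s <= K * big_entries m s)%N.
Proof.
move=> us ms m0 sK.
have cnt (P : 'I_d -> pred X) (Q : pred X) :
    (\sum_(j < d) count (fun y => Q y && P j y) s = \sum_(y <- s | Q y) #|[set j | P j y]%SET|)%N.
  under [LHS]eq_bigr => j _ do rewrite -sum1_count big_mkcondr.
  rewrite exchange_big /=; apply: eq_bigr => y _.
  by rewrite -sum1dep_card [RHS]big_mkcond.
have lower i : ((d - K) * count (fun y => m < `|crd y i|)%N s <=
    \sum_(j < d) count (fun y => (m < `|crd y i|) && (crd y j == 0%R))%N s)%N.
  rewrite (cnt (fun j y => crd y j == 0)) -sum1_count big_distrr /= big_seq_cond [X in (_ <=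
    X)%N]big_seq_cond.
  apply: leq_sum => y /andP[ys _]; rewrite muln1.
  have := cardsC [set c | crd y c != 0]%SET; rewrite card_ord.
  have -> : ~: [set c | crd y c != 0]%SET = [set c | crd y c == 0]%SET.
    by apply/setP => c; rewrite !inE negbK.
  by have := sK y ys; rewrite /supp => h1 h2; rewrite leq_subLR -[X in (X <= _)%N]h2 leq_add2r.
have upper i : (\sum_(j < d) count (fun y => (m <= `|crd y i|) && (crd y j != 0%R))%N s <=
    K * count (fun y => m <= `|crd y i|)%N s)%N.
  rewrite (cnt (fun j y => crd y j != 0)) -sum1_count big_distrr /= big_seq_cond [X in (_ <=
    X)%N]big_seq_cond.
  by apply: leq_sum => y /andP[ys _]; rewrite muln1; exact: sK.
have mid i j : (2 * count (fun y => (m < `|crd y i|) && (crd y j == 0%R))%N s <=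
    count (fun y => (m <= `|crd y i|) && (crd y j != 0%R))%N s)%N.
  have := count_unit_move i j false us ms m0; have := count_unit_move i j true us ms m0.
  rewrite expr0 expr1; set A := count _ s; set B := count _ s; set D := count _ s.
  suff : (B + D <= count (fun y => (m <= `|crd y i|) && (crd y j != 0%R))%N s)%N by lia.
  rewrite /B /D -count_predUI [X in (_ + X <= _)%N](_ : _ = 0)%N.
    rewrite addn0; apply: sub_count => y /= /orP[] /andP[-> /eqP ->] //.
  apply/eqP; rewrite -leqn0 leqNgt -has_count; apply/hasPn => y _ /=.
  by case: (eqVneq (crd y j) (-1)) => [->|_]; rewrite ?andbF.
rewrite /big_entries !big_distrr /=; apply: leq_sum => i _.
rewrite -mulnA; apply: leq_trans (upper i).
apply: (@leq_trans (2 * \sum_(j < d) count (fun y => (m < `|crd y i|) && (crd y j == 0%R))%N s)).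
  by rewrite leq_mul2l lower orbT.
by rewrite big_distrr; apply: leq_sum => j _; exact: mid.
Qed.

(** Each step gains K / (2(d - K)) <= K / d, as 2K <= d. The iteration starts from the nonzero
    entries, of which a point has at most [K]. *)
Lemma big_entries_bound l K s : uniq s -> move_closed s -> (2 * K <= d)%N ->
  (forall y, y \in s -> supp y <= K)%N ->
  (d ^ l * big_entries l.+1 s <= K ^ l.+1 * size s)%N.
Proof.
move=> us ms Kd sK; elim: l => [|l IH].
  rewrite mul1n expn1 /big_entries.
  under eq_bigr do rewrite -sum1_count big_mkcond.
  rewrite exchange_big -sum1_size big_distrr /= !big_seq; apply: leq_sum => y ys.
  rewrite muln1 -big_mkcond /=; apply: leq_trans (sK y ys).
  by rewrite /supp -sum1dep_card; under eq_bigl do rewrite lt0n absz_eq0.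
have step := big_entries_step us ms (ltn0Sn l) sK.
have dK : (d <= 2 * (d - K))%N by lia.
rewrite expnS -mulnA mulnCA (expnS K) -mulnA.
apply: (@leq_trans (d ^ l * (2 * (d - K) * big_entries l.+2 s))).
  by rewrite leq_mul2l leq_mul2r dK !orbT.
apply: (@leq_trans (d ^ l * (K * big_entries l.+1 s))); first by rewrite leq_mul2l step orbT.
by rewrite mulnCA leq_mul2l IH orbT.
Qed.

Definition has_big m y := [exists i, m < `|crd y i|]%N.

Lemma count_has_big l K s : uniq s -> move_closed s -> (2 * K <= d)%N ->
  (forall y, y \in s -> supp y <= K)%N ->
  (d ^ l * count (has_big l) s <= K ^ l.+1 * size s)%N.
Proof.
move=> us ms Kd sK; apply: leq_trans (big_entries_bound l us ms Kd sK).
rewrite leq_mul2l; apply/orP; right.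
rewrite /big_entries -sum1_count; under [X in (_ <= X)%N]eq_bigr do rewrite -sum1_count
  big_mkcond.
rewrite exchange_big big_mkcond; apply: leq_sum => y _.
rewrite /has_big; case: ifP => // /existsP[i hi].
by rewrite (bigD1 i) //= hi.
Qed.

End unit_moves.

Section box.
Variable d : nat.
Local Notation X := (lattice d).

Definition box (M : nat) : seq X :=
  [seq (\row_c ((g c : nat)%:Z - M%:Z) : X) | g : {ffun 'I_d -> 'I_(2 * M).+1}].

Lemma size_box M : size (box M) = ((2 * M).+1 ^ d)%N.
Proof. by rewrite size_map -cardE card_ffun !card_ord. Qed.

Lemma mem_box M (y : X) : (forall c, `|crd y c| <= M)%N -> y \in box M.
Proof.
move=> yM; apply/mapP.
have lt c : (`|(crd y c + M%:Z)%R| < (2 * M).+1)%N by have := yM c; lia.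
exists [ffun c => Ordinal (lt c)]; first by rewrite mem_enum.
apply: crd_eq => c; rewrite {2}/crd mxE ffunE /=; have := yM c; lia.
Qed.
End box.

(** * Convexity and symmetry of the body and of its lattice points *)

Section geometry.
Variables (R : realType) (d : nat) (G : set 'rV[R]_d).
Hypothesis hG : sym_convex_bodies G.
Local Notation X := (lattice d).
Implicit Types (x : 'rV[R]_d) (y : X) (t : R).

Lemma of_latticeE y c : of_lattice (R := R) y ord0 c = (crd y c)%:~R.
Proof. by rewrite /of_lattice mxE. Qed.

Lemma body_convex x x' (l : R) : 0 <= l -> l <= 1 -> G x -> G x' ->
  G (l *: x + (1 - l) *: x').
Proof.
move=> l0 l1 Gx Gx'; have [[_ _ cG _] _] := hG.
by have /set_mem := cG x x' (Itv01 l0 l1) (mem_set Gx) (mem_set Gx').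
Qed.

Lemma body_sym x (e : 'I_d -> bool) (s : 'S_d) : G x ->
  G (\row_c ((-1) ^+ e c * x ord0 (s c))).
Proof.
move=> Gx; have [_ [permG signG]] := hG.
have := signG e _ (permG s _ Gx); congr G.
by apply/rowP => c; rewrite !mxE.
Qed.

Lemma body0 : G 0.
Proof.
have [[_ _ _ [x /interior_subset Gx]] _] := hG.
have Gnx := body_sym (fun=> true) 1%g Gx.
have h0 : 0 <= 2^-1 :> R by rewrite invr_ge0.
have h1 : 2^-1 <= 1 :> R by rewrite invf_le1 // ler1n.
have := body_convex h0 h1 Gx Gnx; congr G; apply/rowP => c; by rewrite !mxE perm1 expr1; field.
Qed.

Lemma body_bound : exists M : nat, forall x c, G x -> `|x ord0 c| <= M%:R.
Proof.
have [[_ [M0 [_ bG]] _ _] _] := hG.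
exists (Num.Def.archi_bound `|M0|).+1 => x c Gx.
have M0lt : M0 < (Num.Def.archi_bound `|M0|).+1%:R.
  apply: (le_lt_trans (ler_norm _)); apply: (lt_trans (archi_boundP (normr_ge0 _))).
  by rewrite ltr_nat.
apply: le_trans (bG _ M0lt x Gx).
by rewrite /Num.Def.normr /= mx_normrE; exact: (le_bigmax _ _ (ord0, c)).
Qed.

Lemma dilateP t x : 0 < t -> dilate t G x <-> G (t^-1 *: x).
Proof.
move=> t0; have tn0 : t != 0 by rewrite gt_eqF.
split=> [[z Gz <-]|Gz]; first by rewrite scalerA mulVf // scale1r.
by exists (t^-1 *: x) => //; rewrite scalerA mulfV // scale1r.
Qed.

Lemma dilate_le t t' x : 0 < t -> t <= t' -> dilate t G x -> dilate t' G x.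
Proof.
move=> t0 tt'; have t'0 := lt_le_trans t0 tt'.
move=> /(dilateP _ t0) Gx; apply/(dilateP _ t'0).
have l0 : 0 <= t / t' by rewrite divr_ge0 // ltW.
have l1 : t / t' <= 1 by rewrite ler_pdivrMr // mul1r.
have := body_convex l0 l1 Gx body0; congr G.
by rewrite scaler0 addr0 scalerA; congr (_ *: _); field; rewrite !gt_eqF.
Qed.

Lemma finite_lattice_points t : 0 < t ->
  finite_set [set y : X | dilate t G (of_lattice y)].
Proof.
move=> t0; have [M hM] := body_bound.
pose M' := Num.Def.archi_bound (t * M%:R).
apply: (@sub_finite_set _ _ [set` box d M']) => [y /= Gy|]; last exact: finite_seq.
apply: mem_box => c; have [z Gz zy] := Gy.
have : `|(crd y c)%:~R| <= t * M%:R :> R.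
  rewrite -of_latticeE -zy mxE normrM gtr0_norm //.
  by apply: ler_wpM2l; [exact: ltW | exact: hM].
have tM0 : 0 <= t * M%:R by rewrite mulr_ge0 // ltW.
move=> /le_lt_trans/(_ (archi_boundP tM0)); rewrite -/M'.
by rewrite -intr_norm -[M'%:R]/(M'%:~R) ltr_int; lia.
Qed.

Definition points t : {fset X} := lattice_points (dilate t G).

Lemma mem_points t y : 0 < t -> y \in points t <-> G (t^-1 *: of_lattice y).
Proof.
move=> t0; rewrite /points /lattice_points in_fset_set; last exact: finite_lattice_points.
split; first by move/set_mem => /(dilateP _ t0).
by move=> Gy; apply: mem_set; apply/(dilateP _ t0).
Qed.

Lemma points_le t t' : 0 < t -> t <= t' -> {subset points t <= points t'}.
Proof.
move=> t0 tt' y /(mem_points _ t0)/(dilateP _ t0) Gy.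
have t'0 := lt_le_trans t0 tt'.
by apply/(mem_points _ t'0)/(dilateP _ t'0); exact: dilate_le Gy.
Qed.

Lemma points0 t : 0 < t -> (0 : X) \in points t.
Proof.
move=> t0; apply/(mem_points _ t0); have := body0; congr G.
by apply/rowP => c; rewrite !mxE mulr0.
Qed.

Lemma points_sym t y (a : {ffun 'I_d -> bool}) (s : 'S_d) : 0 < t ->
  y \in points t -> signs a (fun c => crd y (s c)) \in points t.
Proof.
move=> t0 /(mem_points _ t0) Gy; apply/(mem_points _ t0).
have := body_sym a s Gy; congr G; apply/rowP => c.
rewrite !mxE rmorphM rmorphXn rmorphN1 /= /crd; ring.
Qed.

(* The move is a convex combination of y and of its image under the
   transposition (i j) composed with a sign change at j. *)
Lemma points_move t : 0 < t -> move_closed (points t).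
Proof.
move=> t0 y i j b /(mem_points _ t0) Gy ij yi yj; apply/(mem_points _ t0).
pose m : R := `|(crd y i)%:~R|.
have m1 : 1 <= m by rewrite /m -intr_norm ler1z; lia.
(* As entry [j] vanishes, the transposed point has 0 at [i] and, by this choice of sign, (-1)^b m at
   [j]. Weight 1/m on it lowers |y_i| by 1 and puts (-1)^b at [j]. *)
pose a c := if c == j then b (+) (crd y i < 0) else false.
have Gz := body_sym a (tperm i j) Gy.
have l0 : 0 <= 1 - m^-1 by rewrite subr_ge0 invf_le1 // (lt_le_trans _ m1).
have l1 : 1 - m^-1 <= 1 by rewrite gerBl invr_ge0 (le_trans _ m1).
have := body_convex l0 l1 Gy Gz; congr G; apply/rowP => c.
rewrite !mxE -!/(crd y _).
have yE : (crd y i)%:~R = (sgz (crd y i))%:~R * m :> R.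
  by rewrite /m -intr_norm -intrM; congr _%:~R; lia.
have m0 : m != 0 by rewrite gt_eqF // (lt_le_trans _ m1).
have t0' : t != 0 by rewrite gt_eqF.
case: (eqVneq c i) => [->|ci].
  by rewrite tpermL yj /= !mulr0 addr0 intrB yE; field; rewrite m0 t0'.
case: (eqVneq c j) => [->|cj].
  rewrite tpermR yj /a eqxx !mulr0 add0r.
  have -> : (crd y i)%:~R = (-1) ^+ (crd y i < 0)%R * m :> R.
    by rewrite /m -intr_norm -[in RHS](rmorphN1 intr) -rmorphXn -intrM; congr _%:~R;
      exact: numEsign.
  rewrite signr_addb rmorphXn rmorphN1 /=.
  transitivity (t^-1 * ((-1) ^+ b) * (((-1) ^+ (crd y i < 0)%R) ^+ 2) : R); first by field;
    rewrite ?m0 ?t0'.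
  by rewrite sqrr_sign mulr1.
by rewrite tpermD 1?eq_sym // /a (negPf cj) expr0; field; rewrite ?m0 ?t0'.
Qed.

End geometry.

Lemma ler_sum_uniq_subset (R : realType) (T : eqType) (A B : seq T) (P : pred T) (F : T -> R) :
  uniq A -> uniq B -> {subset A <= B} -> (forall y, 0 <= F y) ->
  \sum_(y <- A | P y) F y <= \sum_(y <- B | P y) F y.
Proof.
move=> uA uB AB F0.
have pA : perm_eq A [seq y <- B | y \in A].
  apply: uniq_perm; rewrite ?filter_uniq // => y; rewrite mem_filter.
  by case yA: (y \in A) => //=; rewrite AB.
rewrite (perm_big _ pA) big_filter_cond /= [leRHS](bigID (mem A)) /=.
rewrite (eq_bigl (fun y => P y && (y \in A))) => [|y]; last by rewrite andbC.
by rewrite lerDl sumr_ge0.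
Qed.

(** * Averages over finite sets and their dyadic size classes *)

Section averages.
Variables (R : realType) (d : nat).
Local Notation X := (lattice d).
Implicit Types (f : X -> R) (s : seq X) (P : pred X).

Definition seq_avg s P f x : R := (size s)%:R^-1 * \sum_(y <- s | P y) f (x - y).

Lemma seq_avg_ge0 s P f x : (forall x, 0 <= f x) -> 0 <= seq_avg s P f x.
Proof. by move=> f0; rewrite mulr_ge0 ?invr_ge0 // sumr_ge0. Qed.

(** The mean is normalised by all of [s] but sums only over [P]: it is convolution with a measure of
    mass at most [delta]. *)
Lemma seq_avg_bound s P f (delta : R) : (forall x, 0 <= f x) -> 0 <= delta ->
  (count P s)%:R <= delta * (size s)%:R ->
  (lsum (fun x => seq_avg s P f x ^+ 2)%R <= (delta ^+ 2)%:E * lsum (fun x => f x ^+ 2)%R)%E.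
Proof.
move=> f0 delta0 cs.
have I0 : (0 <= lsum (fun x => f x ^+ 2)%R)%E by apply: lsum_ge0 => x; exact: sqr_ge0.
set n := size s; set s' := [seq y <- s | P y].
pose c : R := n%:R^-1 ^+ 2 * (size s')%:R.
have c0 : 0 <= c by rewrite mulr_ge0 ?sqr_ge0.
have F0 y x : 0 <= f (x - y) ^+ 2 by exact: sqr_ge0.
apply: (@le_trans _ _ (lsum (fun x => c * \sum_(y <- s') f (x - y) ^+ 2))).
  apply: ler_lsum => x; rewrite sqr_ge0 /seq_avg -big_filter -/s' -/n /= exprMn /c -[leRHS]mulrA.
  apply: ler_wpM2l; first exact: sqr_ge0.
  have -> : \sum_(y <- s') f (x - y) = \sum_(y <- s') 1 * f (x - y).
    by apply: eq_bigr => y _; rewrite mul1r.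
  have -> : \sum_(y <- s') f (x - y) ^+ 2 = \sum_(y <- s') 1 * f (x - y) ^+ 2.
    by apply: eq_bigr => y _; rewrite mul1r.
  have -> : (size s')%:R = \sum_(y <- s') (1 : R) by rewrite big_const_seq count_predT
    iter_addr_0.
  by apply: sum_sqr_le.
have S0 x : 0 <= \sum_(y <- s') f (x - y) ^+ 2 by rewrite sumr_ge0.
rewrite (lsumZ c0 S0) lsum_sum //.
have tr y : lsum (fun x => f (x - y) ^+ 2) = lsum (fun x => f x ^+ 2).
  apply: (@lsum_bij R d (fun x => x - y) (fun x => x + y) (fun x => f x ^+ 2)).
  - by move=> x; rewrite subrK.
  - by move=> x; rewrite addrK.
  - by move=> x; exact: sqr_ge0.
rewrite (eq_bigr (fun=> lsum (fun x => f x ^+ 2))) => [|y _]; last exact: tr.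
have -> : (\sum_(y <- s') lsum (fun x => f x ^+ 2)%R = (size s')%:R%:E * lsum (fun x => f x ^+
  2)%R)%E.
  elim: {c c0 S0} s' => [|y s' IH]; first by rewrite big_nil mul0e.
  by rewrite big_cons IH /= -natr1 EFinD ge0_muleDl ?lee_fin // mul1e addeC.
rewrite muleA -EFinM; apply: lee_wpmul2r => //; rewrite lee_fin /c size_filter -/n.
have [n0|n0] := eqVneq n 0%N.
  by rewrite n0 invr0 expr0n !mul0r sqr_ge0.
have nR : 0 < n%:R :> R by rewrite ltr0n lt0n.
have -> : n%:R^-1 ^+ 2 * (count P s)%:R * (count P s)%:R = ((count P s)%:R / n%:R) ^+ 2 :> R.
  by rewrite exprMn expr2 expr2; ring.
by rewrite lerXn2r ?nnegrE // ?divr_ge0 // ler_pdivrMr.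
Qed.

End averages.

Section dyadic.
Variables (R : realType) (d : nat) (G : set 'rV[R]_d).
Hypothesis hG : sym_convex_bodies G.
Local Notation X := (lattice d).
Variable adm : set R.
Hypothesis adm0 : forall t, adm t -> 0 < t.
Local Notation pts t := (points G t).

Lemma card_points_gt0 t : adm t -> (0 < #|` pts t|)%N.
Proof. by move=> at_; rewrite cardfs_gt0; apply/fset0Pn; exists 0; apply: points0 => //;
  exact: adm0. Qed.

(* The sets pts t are nested, so the largest one in a dyadic size class contains
   the others. *)
Lemma dyadic_representatives : exists S : nat -> {fset X},
  [/\ forall k, S k = fset0 \/ exists2 t, adm t & S k = pts t,
      forall t, adm t -> {subset pts t <= S (trunc_log 2 #|` pts t|)} &
      forall t, adm t -> (#|` S (trunc_log 2 #|` pts t|)| <= 2 * #|` pts t|)%N].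
Proof.
pose good k (A : {fset X}) := (A = fset0 \/ exists2 t, adm t & A = pts t) /\
  (forall t, adm t -> trunc_log 2 #|` pts t| = k ->
    {subset pts t <= A} /\ (#|` A| <= 2 * #|` pts t|)%N).
suff /choice[S hS] : forall k, exists A, good k A.
  exists S; split=> [k|t at_|t at_]; first by case: (hS k).
  - by have [_ /(_ t at_ erefl)[]] := hS (trunc_log 2 #|` pts t|).
  - by have [_ /(_ t at_ erefl)[]] := hS (trunc_log 2 #|` pts t|).
move=> k.
pose P n := `[< exists t, [/\ adm t, trunc_log 2 #|` pts t| = k & #|` pts t| = n] >].
have [exP|nP] := pselect (exists n, P n); last first.
  exists fset0; split=> [|t at_ kt]; first by left.
  by case: nP; exists #|` pts t|; apply/asboolP; exists t.
have bound n : P n -> (n <= 2 ^ k.+1)%N.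
  move=> /asboolP[t [at_ kt <-]]; apply: ltnW; rewrite -kt.
  exact: trunc_log_ltn.
case: (ex_maxnP exP bound) => n /asboolP[t [at_ kt nt]] nmax.
exists (pts t); split=> [|t' at'_ kt']; first by right; exists t.
have n't : (#|` pts t'| <= #|` pts t|)%N by rewrite nt; apply: nmax; apply/asboolP; exists t'.
split.
  case: (leP t t') => tt'.
    have /fsubsetP sub := points_le hG (adm0 at_) tt'.
    have /eqP -> // : pts t == pts t'.
    by rewrite eqEfcard sub n't.
  exact: (points_le hG (adm0 at'_) (ltW tt')).
have lo : (2 ^ k <= #|` pts t'|)%N by rewrite -kt'; apply: trunc_logP => //;
  exact: card_points_gt0.
have up : (#|` pts t| < 2 ^ k.+1)%N by rewrite -kt; exact: trunc_log_ltn.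
by rewrite expnS in up; lia.
Qed.

(** Each mean is at most twice that over the representative of its size class, whence the factor 4;
    the supremum over the at most [M] classes is replaced by a sum. *)
Lemma dyadic_maximal (P : pred X) (delta : R) (M : nat) (f : X -> R) :
  (forall x, 0 <= f x) -> 0 <= delta ->
  (forall t, adm t -> (count P (pts t))%:R <= delta * (#|` pts t|)%:R) ->
  (forall t, adm t -> #|` pts t| < 2 ^ M)%N ->
  exists H : X -> R, [/\ forall x, 0 <= H x,
    (lsum H <= (4 * M%:R * delta ^+ 2)%:E * lsum (fun x => f x ^+ 2)%R)%E &
    forall t x, adm t -> seq_avg (pts t) P f x ^+ 2 <= H x].
Proof.
move=> f0 delta0 hP hM.
have [S [S1 S2 S3]] := dyadic_representatives.
exists (fun x => 4 * \sum_(k < M) seq_avg (S k) P f x ^+ 2).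
have H0 x : 0 <= \sum_(k < M) seq_avg (S k) P f x ^+ 2.
  by apply: sumr_ge0 => k _; exact: sqr_ge0.
have I0 : (0 <= lsum (fun x => f x ^+ 2)%R)%E by apply: lsum_ge0 => x; exact: sqr_ge0.
split=> [x||t x at_]; first by rewrite mulr_ge0.
- rewrite (lsumZ (ler0n R 4) H0) lsum_sum; last by move=> k x; exact: sqr_ge0.
  rewrite -mulrA EFinM -muleA; apply: lee_wpmul2l; first by rewrite lee_fin.
  rewrite EFinM -muleA -[X in (X%:R)%:E](card_ord M) -sume_const; last first.
    by rewrite mule_ge0 // lee_fin sqr_ge0.
  apply: lee_sum => k _; apply: seq_avg_bound => //.
  case: (S1 k) => [->|[t at_ ->]]; last exact: hP.
  have -> : enum_fset (fset0 : {fset X}) = [::] by apply: size0nil; exact: cardfs0.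
  by rewrite mulr0.
- have kM : (trunc_log 2 #|` pts t| < M)%N.
    have h1 := hM t at_; have h2 := trunc_logP (p := 2) isT (card_points_gt0 at_).
    by rewrite -(ltn_exp2l _ _ (isT : (1 < 2)%N)); exact: leq_ltn_trans h2 h1.
  set k := trunc_log 2 _ in kM.
  apply: (@le_trans _ _ (4 * seq_avg (S k) P f x ^+ 2)); last first.
    rewrite ler_pM2l // (bigD1 (Ordinal kM)) //= lerDl.
    by apply: sumr_ge0 => i _; exact: sqr_ge0.
  have -> : 4 * seq_avg (S k) P f x ^+ 2 = (2 * seq_avg (S k) P f x) ^+ 2 by ring.
  have g0 s : 0 <= seq_avg s P f x by exact: seq_avg_ge0.
  have g1 : 0 <= 2 * seq_avg (S k) P f x by apply: mulr_ge0.
  rewrite lerXn2r ?nnegrE ?g0 ?g1 //.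
  rewrite /seq_avg [leRHS]mulrA; apply: ler_pM.
  + by rewrite invr_ge0.
  + exact: sumr_ge0.
  + have p0 : 0 < (#|` pts t|)%:R :> R by rewrite ltr0n card_points_gt0.
    have s0 : 0 < (#|` S k|)%:R :> R.
      rewrite ltr0n cardfs_gt0; apply/fset0Pn; exists 0; apply: S2 => //.
      by apply: points0 => //; exact: adm0.
    rewrite -[size _]/(#|` pts t|) -[size (S k)]/(#|` S k|) ler_pdivlMr // mulrC ler_pdivrMr //.
    by rewrite -natrM ler_nat; exact: S3.
  + by apply: ler_sum_uniq_subset; [exact: fset_uniq | exact: fset_uniq | exact: (S2 t at_) |].
Qed.

End dyadic.

(** * The maximal theorem *)

Section l1_size.
Variable d : nat.
Local Notation X := (lattice d).
Implicit Types y : X.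

Definition l1size y := (\sum_(c < d) `|crd y c|)%N.

Lemma supp_le_l1size y : (supp y <= l1size y)%N.
Proof.
rewrite /supp -sum1dep_card big_mkcond; apply: leq_sum => c _.
by case: ifP => //; rewrite -absz_eq0 lt0n => ->.
Qed.

Lemma crd_le_l1size y c : (`|crd y c| <= l1size y)%N.
Proof. by rewrite /l1size (bigD1 c) //= leq_addr. Qed.

Lemma card_level_le_supp y i : (#|[set c | `|crd y c| == i.+1]%N%SET| <= supp y)%N.
Proof.
rewrite /supp; apply/subset_leq_card/fintype.subsetP => c; rewrite !inE => /eqP h.
by rewrite -absz_eq0 h.
Qed.

End l1_size.

Section l2.
Variables (R : realType) (eps : R).
Hypothesis eps0 : 0 < eps.

Section fixed_body.
Variables (d : nat) (G : set 'rV[R]_d).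
Hypothesis d0 : (0 < d)%N.
Hypothesis hG : sym_convex_bodies G.
Local Notation X := (lattice d).

Definition admissible : set R :=
  [set t | 0 < t /\ kappa (dilate t G) <= d%:R `^ (- eps)].

(** Integer part of d^(1 - eps), the largest l^1 size that an admissible lattice point can have. *)
Definition max_l1size : nat := Num.truncn (d%:R * d%:R `^ (- eps) : R).

Lemma dR_gt0 : 0 < d%:R :> R. Proof. by rewrite ltr0n. Qed.

Lemma max_l1size_le : max_l1size%:R <= d%:R * d%:R `^ (- eps) :> R.
Proof. by rewrite truncn_le mulr_ge0 // powR_ge0. Qed.

Lemma max_l1size_le_d : (max_l1size <= d)%N.
Proof.
rewrite -(ler_nat R); apply: (le_trans max_l1size_le).
have d1 : 1 <= d%:R :> R by rewrite ler1n.
have e0 : - eps <= 0 by rewrite oppr_le0 ltW.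
have := ler_powR d1 e0; rewrite powRr0 => h.
by rewrite -[leRHS]mulr1 ler_wpM2l.
Qed.

Lemma admissible_gt0 t : admissible t -> 0 < t. Proof. by case. Qed.

Lemma admissible_l1size t y : admissible t -> y \in points G t -> (l1size y <= max_l1size)%N.
Proof.
move=> [t0 kt] yt.
rewrite truncn_ge_nat; last by rewrite mulr_ge0 // powR_ge0.
have le_kappa : l1norm (of_lattice (R := R) y) / d%:R <= kappa (dilate t G).
  exact: (@le_bigmax_seq _ _ _ _ 0 y predT (fun x => l1norm (of_lattice (R := R) x) / d%:R)).
have := le_trans le_kappa kt; rewrite ler_pdivrMr ?dR_gt0 // mulrC; congr (_ <= _).
rewrite /l1norm natr_sum; apply: eq_bigr => c _.
by rewrite of_latticeE -intr_norm -abszE.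
Qed.

(** The points lie in a box of side 2d + 1. Only the order d^2 of the number of dyadic classes
    matters later. *)
Lemma card_points_lt t : admissible t -> (#|` points G t| < 2 ^ (3 * d ^ 2))%N.
Proof.
move=> at_; apply: (@leq_ltn_trans ((2 * d).+1 ^ d)).
  rewrite -size_box; apply: uniq_leq_size; first exact: fset_uniq.
  move=> y yt; apply: mem_box => c; apply: leq_trans (crd_le_l1size y c) _.
  exact: leq_trans (admissible_l1size at_ yt) max_l1size_le_d.
apply: (@leq_ltn_trans ((2 ^ (2 * d)) ^ d)).
  by rewrite leq_exp2r // ltn_expl.
by rewrite -expnM ltn_exp2l //; nia.
Qed.

(** Used in bounded dimension, where summing trivially over all 3d^2 dyadic classes is
    affordable. *)
Lemma l2_small (f : X -> R) : (forall x, 0 <= f x) ->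
  exists H : X -> R, [/\ forall x, 0 <= H x,
    (lsum H <= (12 * d%:R ^+ 2)%:E * lsum (fun x => f x ^+ 2)%R)%E &
    forall t x, admissible t -> seq_avg (points G t) predT f x ^+ 2 <= H x].
Proof.
move=> f0.
have triv t : admissible t -> (count predT (points G t))%:R <= 1 * (#|` points G t|)%:R :> R.
  by move=> _; rewrite count_predT mul1r.
have [H [H0 HI HM]] := dyadic_maximal hG admissible_gt0 f0 ler01 triv card_points_lt.
exists H; split=> //; move: HI; congr (_ <= _ * _)%E; congr (_%:E).
by rewrite natrM natrX; ring.
Qed.

Section large.
Variables (L : nat) (C : R).
Hypotheses (L_eps : 2 <= eps * L%:R) (L0 : (0 < L)%N).
Hypothesis KN : (64 * max_l1size <= d %/ L)%N.
Hypothesis N0 : (0 < d %/ L)%N.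
Hypotheses (C_ge0 : 0 <= C) (cube_bound : forall g : {set 'I_(d %/ L)} -> R,
  (forall I, 0 <= g I) -> \sum_J max_sphere g J ^+ 2 <= C * \sum_J g J ^+ 2).

(** With K <= d^(1 - eps) and eps L >= 2 one gets K^(L+1) <= d^(L-1), so [count_has_big] leaves a
    fraction at most 1/d. *)
Lemma few_big_entries t : admissible t ->
  (count (has_big L) (points G t))%:R <= (d%:R^-1) * (#|` points G t|)%:R :> R.
Proof.
move=> at_; set K := max_l1size.
have t0 := admissible_gt0 at_.
have dL : (d %/ L <= d)%N by exact: leq_div.
have := @count_has_big d L K (points G t) (fset_uniq _) (points_move hG t0) _ _.
have K2 : (2 * K <= d)%N by rewrite /K; lia.
have sK y : y \in points G t -> (supp y <= K)%N.
  by move=> yt; exact: leq_trans (supp_le_l1size y) (admissible_l1size at_ yt).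
move=> /(_ K2 sK); set cnt := count _ _; rewrite -[size _]/(#|` points G t|).
set S := #|` _|; rewrite -(ler_nat R) !natrM !natrX => h.
have dp := dR_gt0; have d1 : 1 <= d%:R :> R by rewrite ler1n.
have KL : K%:R ^+ L.+1 <= d%:R ^+ L.+1 * d%:R ^- 2 :> R.
  apply: (@le_trans _ _ ((d%:R * d%:R `^ (- eps)) ^+ L.+1)).
    by rewrite lerXn2r ?nnegrE ?max_l1size_le // mulr_ge0 // powR_ge0.
  rewrite exprMn ler_wpM2l ?exprn_ge0 // -powR_mulrn ?powR_ge0 // -powRrM.
  rewrite -powR_invn //; apply: ler_powR => //.
  rewrite mulNr lerN2 -[L.+1%:R]natr1 mulrDr mulr1; move: L_eps eps0 => h1 h2; lra.
have dn0 : d%:R != 0 :> R by rewrite gt_eqF.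
rewrite ler_pdivlMl // -(ler_pM2l (exprn_gt0 L dp)).
have -> : d%:R ^+ L * (d%:R * cnt%:R) = d%:R * (d%:R ^+ L * cnt%:R) :> R by ring.
apply: (@le_trans _ _ (d%:R * (d%:R ^+ L.+1 * d%:R ^- 2 * S%:R))).
  by rewrite ler_pM2l //; apply: (le_trans h); rewrite ler_wpM2r.
by rewrite le_eqVlt exprS; apply/orP; left; apply/eqP; field.
Qed.

Lemma blocks_fit : (L * (d %/ L) <= d)%N.
Proof. by rewrite mulnC leq_divM. Qed.

(** The point set and the bound on entries are invariant under signed permutations, so [f (x - y)]
    may be replaced by [orbit_avg f x y]. Each level of |y| is attained at most [max_l1size] times,
    which [KN] makes small enough for [orbit_avg_le]. *)
Lemma good_average_le t (f : X -> R) x : admissible t -> (forall x, 0 <= f x) ->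
  seq_avg (points G t) (predC (has_big L)) f x <= strong_max blocks_fit f x.
Proof.
move=> at_ f0; have t0 := admissible_gt0 at_.
set S := points G t; set P := predC (has_big L).
have sym (a : {ffun 'I_d -> bool}) (s : 'S_d) :
    \sum_(y <- S | P y) f (x - signs a (fun c => crd y (s c))) = \sum_(y <- S | P y) f (x - y).
  pose phi (y : X) := signs a (fun c => crd y (s c)).
  have phi_inj : injective phi.
    move=> y z e; apply: crd_eq => c; have := congr1 (fun v => crd v (s^-1%g c)) e.
    by rewrite !crd_signs permKV => /(can_inj (signrMK _)).
  have phiP y : P (phi y) = P y.
    congr (~~ _); apply/existsP/existsP => -[c hc].
      by exists (s c); move: hc; rewrite crd_signs abszMsign.
    by exists (s^-1%g c); rewrite crd_signs abszMsign permKV.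
  have phiS : perm_eq (map phi S) S.
    have uS : uniq (map phi S) by rewrite map_inj_uniq ?fset_uniq.
    apply: uniq_perm => //; first exact: fset_uniq.
    have sub : {subset map phi S <= S} by move=> z /mapP[y yS ->]; exact: points_sym.
    have sz : (size S <= size (map phi S))%N by rewrite size_map.
    exact: (uniq_min_size uS sub sz).2.
  rewrite -[RHS](perm_big _ phiS) big_map; by apply: eq_bigl => y; rewrite phiP.
have S0 : 0 < (size S)%:R :> R by rewrite ltr0n; exact: (card_points_gt0 hG admissible_gt0 at_).
rewrite /seq_avg ler_pdivrMl //.
have -> : \sum_(y <- S | P y) f (x - y) = \sum_(y <- S | P y) orbit_avg f x y.
  rewrite /orbit_avg /Omega_avg -mulr_sumr exchange_big /=.
  rewrite -[LHS](Omega_avg_cst d); congr (_ * _); apply: eq_bigr => w _.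
  by rewrite -(sym w.2 w.1).
apply: (@le_trans _ _ (\sum_(y <- S | P y) strong_max blocks_fit f x)).
  rewrite big_seq_cond [leRHS]big_seq_cond; apply: ler_sum => y /andP[yS Py].
  apply: orbit_avg_le => // [c|i].
    by move: Py; rewrite /P /= /has_big negb_exists => /forallP/(_ c); rewrite -leqNgt.
  apply: leq_trans KN; rewrite leq_mul2l /=; apply: (leq_trans (card_level_le_supp y i)).
  exact: (leq_trans (supp_le_l1size y) (admissible_l1size at_ yS)).
rewrite big_const_seq iter_addr_0 -[leLHS]mulr_natl ler_wpM2r ?strong_max_ge0 //.
by rewrite ler_nat count_size.
Qed.

Lemma l2_large (f : X -> R) : (forall x, 0 <= f x) ->
  exists H : X -> R, [/\ forall x, 0 <= H x,
    (lsum H <= (2 * C ^+ L + 24)%:E * lsum (fun x => f x ^+ 2)%R)%E &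
    forall t x, admissible t -> seq_avg (points G t) predT f x ^+ 2 <= H x].
Proof.
move=> f0.
have delta0 : 0 <= d%:R^-1 :> R by rewrite invr_ge0.
have [H [H0 HI HM]] := dyadic_maximal hG admissible_gt0 f0 delta0 few_big_entries card_points_lt.
pose SM x := strong_max blocks_fit f x.
have SM0 x : 0 <= SM x ^+ 2 by exact: sqr_ge0.
have SMI : (lsum (fun x => SM x ^+ 2)%R <= (C ^+ L)%:E * lsum (fun x => f x ^+ 2)%R)%E.
  exact: strong_max_bound.
pose F (b : bool) x := 2 * (if b then SM x ^+ 2 else H x).
have F0 b x : 0 <= F b x by rewrite /F mulr_ge0 //; case: b.
have I0 : (0 <= lsum (fun x => f x ^+ 2)%R)%E by apply: lsum_ge0 => x; exact: sqr_ge0.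
exists (fun x => \sum_(b : bool) F b x); split=> [x||t x at_].
- by apply: sumr_ge0 => b _.
- rewrite lsum_sum // big_bool /=.
  rewrite (lsumZ (ler0n R 2) SM0) (lsumZ (ler0n R 2) H0).
  have CL0 : 0 <= 2 * C ^+ L by rewrite mulr_ge0 // exprn_ge0.
  have -> : ((2 * C ^+ L + 24)%:E * lsum (fun x => f x ^+ 2)%R =
      (2 * C ^+ L)%:E * lsum (fun x => f x ^+ 2)%R + 24%:E * lsum (fun x => f x ^+ 2)%R)%E.
    by rewrite [X in (X * _)%E = _]EFinD ge0_muleDl // lee_fin.
  apply: leeD.
    by rewrite EFinM -muleA; apply: lee_wpmul2l => //; rewrite lee_fin.
  have -> : 24 = 2 * 12 :> R by rewrite -natrM.
  rewrite EFinM -muleA; apply: lee_wpmul2l; first by rewrite lee_fin.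
  (* The 3d^2 dyadic classes are exactly paid for by the square of the exceptional fraction 1/d. *)
  suff <- : 4 * (3 * d ^ 2)%:R * d%:R^-1 ^+ 2 = 12 :> R by [].
  have dn0 : d%:R != 0 :> R by rewrite gt_eqF // dR_gt0.
  by rewrite natrM natrX; field.
- have good := good_average_le x at_ f0.
  have bad := HM t x at_.
  rewrite big_bool /=.
  have -> : seq_avg (points G t) predT f x =
      seq_avg (points G t) (has_big L) f x + seq_avg (points G t) (predC (has_big L)) f x.
    by rewrite /seq_avg -mulrDr; congr (_ * _); rewrite (bigID (has_big L)).
  have g0 := seq_avg_ge0 (points G t) (predC (has_big L)) x f0.
  have good2 : seq_avg (points G t) (predC (has_big L)) f x ^+ 2 <= SM x ^+ 2.
    by rewrite lerXn2r ?nnegrE //; exact: le_trans good.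
  rewrite /F; move: (seq_avg _ (has_big L) _ _) (seq_avg _ (predC _) _ _) bad good2 => a b bad
    good2.
  by have := sqr_ge0 (a - b); nra.
Qed.

End large.
End fixed_body.
End l2.

Lemma large_dimension (R : realType) (eps : R) (L : nat) : 0 < eps -> (0 < L)%N ->
  exists d0 : nat, forall d, (d0 <= d)%N ->
    (64 * max_l1size eps d <= d %/ L)%N /\ (0 < d %/ L)%N.
Proof.
move=> eps0 L0.
pose M : R := 64 * L%:R.
have M0 : 0 < M by rewrite mulr_gt0 // ltr0n.
(* Beyond this threshold d^eps >= 64 L, which is what 64 L d^(1 - eps) <= d requires. *)
pose A := M `^ eps^-1.
exists (maxn (Num.truncn A).+1 L) => d; rewrite geq_max => /andP[dA dL].
have d0 : 0 < d%:R :> R by rewrite ltr0n; apply: leq_trans dL.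
have Ad : A <= d%:R.
  by apply/ltW/(lt_le_trans (truncnS_gt A)); rewrite ler_nat.
have Md : M <= d%:R `^ eps.
  have -> : M = A `^ eps by rewrite /A -powRrM mulVf ?powRr1 ?gt_eqF // ltW.
  by apply: ge0_ler_powR => //; rewrite ?nnegrE ?powR_ge0 // ltW.
split; last by rewrite divn_gt0.
rewrite leq_divRL // -(ler_nat R) !natrM.
have K := max_l1size_le eps d.
have e0 : 0 < d%:R `^ eps by rewrite powR_gt0.
have h : M * d%:R `^ (- eps) <= 1 by rewrite powRN -/M ler_pdivrMr // mul1r.
have -> : 64 * (max_l1size eps d)%:R * L%:R = M * (max_l1size eps d)%:R :> R.
  by rewrite /M; ring.
apply: (@le_trans _ _ (M * (d%:R * d%:R `^ (- eps)))); first by rewrite ler_pM2l.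
by rewrite mulrCA -[leRHS]mulr1 ler_pM2l.
Qed.

(** One pointwise majorant [H] of all the squares stands in for the supremum over [t]. The dimension
    threshold depends only on [eps], so the small dimensions cost a constant; C >= 1 serves when
    p-th roots are taken. *)
Lemma l2_maximal (R : realType) (eps : R) : 0 < eps ->
  exists2 C : R, 1 <= C & forall (d : nat) (G : set 'rV[R]_d) (f : lattice d -> R),
    (0 < d)%N -> sym_convex_bodies G -> (forall x, 0 <= f x) ->
    exists H : lattice d -> R, [/\ forall x, 0 <= H x,
      (lsum H <= C%:E * lsum (fun x => f x ^+ 2)%R)%E &
      forall t x, admissible eps G t -> seq_avg (points G t) predT f x ^+ 2 <= H x].
Proof.
move=> eps0.
pose L := (Num.truncn (2 / eps)).+1.
have L_eps : 2 <= eps * L%:R.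
  by rewrite -ler_pdivrMl // mulrC; apply/ltW/truncnS_gt.
have [d0 hd0] := large_dimension eps0 (ltn0Sn _ : (0 < L)%N).
pose C0 : R := 848.
have C00 : 0 <= C0 by exact: ler0n.
have C0L : 0 <= C0 ^+ L by exact: exprn_ge0.
pose C : R := 2 * C0 ^+ L + 24 + 12 * d0%:R ^+ 2.
have d00 : 0 <= 12 * d0%:R ^+ 2 :> R by rewrite mulr_ge0 // sqr_ge0.
exists C; first by rewrite /C; lra.
move=> d G f dpos hG f0.
have I0 : (0 <= lsum (fun x => f x ^+ 2)%R)%E by apply: lsum_ge0 => x; exact: sqr_ge0.
case: (leqP d0 d) => [/hd0[KN N0]|dd0].
  have cb (g : {set 'I_(d %/ L)} -> R) : (forall I, 0 <= g I) ->
      \sum_J max_sphere g J ^+ 2 <= C0 * \sum_J g J ^+ 2.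
    by move=> g0; apply: max_sphere_bound => //; rewrite card_ord.
  have [H [H0 HI HM]] := l2_large eps0 dpos hG L_eps (ltn0Sn _) KN N0 C00 cb f0.
  exists H; split=> //; apply: (le_trans HI); apply: lee_wpmul2r => //.
  by rewrite lee_fin /C lerDl.
have [H [H0 HI HM]] := l2_small eps0 dpos hG f0.
exists H; split=> //; apply: (le_trans HI); apply: lee_wpmul2r => //.
rewrite lee_fin /C.
have : 12 * d%:R ^+ 2 <= 12 * d0%:R ^+ 2 :> R.
  by rewrite ler_pM2l // -!natrX ler_nat leq_exp2r // ltnW.
lra.
Qed.

(** * From nonnegative functions on l^2 to complex functions on l^p *)

(** Adding a point makes the new mean a convex combination, with weights 1/(n+1) and n/(n+1), of its
    value and the old mean; convexity of the power then gives the induction. *)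
Lemma jensen_powR (R : realType) (T : Type) (s : seq T) (u : T -> R) (q : R) :
  1 <= q -> (forall y, 0 <= u y) ->
  ((size s)%:R^-1 * \sum_(y <- s) u y) `^ q <= (size s)%:R^-1 * \sum_(y <- s) u y `^ q.
Proof.
move=> q1 u0; have q0 : q != 0 by rewrite gt_eqF // (lt_le_trans _ q1).
elim: s => [|y s IH]; first by rewrite !big_nil !mulr0 powR0.
rewrite !big_cons /=; set n := (size s)%:R in IH.
have n0 : 0 <= n by [].
have S0 : 0 <= n^-1 * \sum_(y <- s) u y by rewrite mulr_ge0 ?invr_ge0 // sumr_ge0.
have nE : (size s).+1%:R = n + 1 :> R by rewrite -natr1.
have t0 : 0 <= (n + 1)^-1 by rewrite invr_ge0 addr_ge0.
have t1 : (n + 1)^-1 <= 1 by rewrite invf_le1 ?ltr_wpDl // lerDr.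
have n1 : n + 1 != 0 by rewrite gt_eqF // ltr_wpDl.
have mix (v : T -> R) : (n + 1)^-1 * (v y + \sum_(z <- s) v z) =
    (n + 1)^-1 * v y + (1 - (n + 1)^-1) * (n^-1 * \sum_(z <- s) v z).
  have [s0|s0] := eqVneq (size s) 0%N.
    by rewrite (size0nil s0) big_nil !mulr0 !addr0.
  by have nn : n != 0 by [rewrite pnatr_eq0]; field; rewrite nn n1.
rewrite nE (mix u) (mix (fun z => u z `^ q)).
have := @convex_powR R q q1 (Itv01 t0 t1) (u y) (n^-1 * \sum_(z <- s) u z).
rewrite !convRE /= => cvx.
have u_in : u y \in (`[0, +oo[%classic : set R) by rewrite inE /= in_itv /= u0.
have m_in : n^-1 * \sum_(z <- s) u z \in (`[0, +oo[%classic : set R) by rewrite inE /= in_itv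
  /= S0.
apply: (le_trans (cvx u_in m_in)).
by rewrite lerD2l ler_wpM2l // subr_ge0.
Qed.

Section complex_average.
Variables (R : realType) (d : nat).
Local Notation X := (lattice d).
Local Notation normc := ComplexField.Normc.normc.
Implicit Types (f : X -> R[i]) (G : set 'rV[R]_d).

Lemma normc_ge0 (z : R[i]) : 0 <= normc z.
Proof. by case: z => a b; exact: sqrtr_ge0. Qed.

Lemma normc_nat n : normc (n%:R : R[i]) = n%:R.
Proof.
elim: n => [|n IH]; first exact: ComplexField.Normc.normc0.
have := normcMn (1 : R[i]) n.+1; rewrite ComplexField.Normc.normc1; exact.
Qed.

Lemma normc_average_le t G f x :
  normc (average t G f x) <= seq_avg (points G t) predT (fun y => normc (f y)) x.
Proof.
rewrite /average /seq_avg -/(points G t) ComplexField.Normc.normcM.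
rewrite ComplexField.Normc.normcV normc_nat ler_wpM2l ?invr_ge0 //.
elim: (enum_fset (points G t)) => [|y s IH].
  by rewrite !big_nil ComplexField.Normc.normc0.
rewrite !big_cons; apply: le_trans (le_normcD _ _) _.
by rewrite lerD2l.
Qed.

End complex_average.

Section maximal_function.
Variables (R : realType) (eps : R) (d : nat) (G : set 'rV[R]_d).
Hypotheses (eps0 : 0 < eps) (d0 : (0 < d)%N) (hG : sym_convex_bodies G).
Local Notation X := (lattice d).
Local Notation normc := ComplexField.Normc.normc.
Implicit Types (f : X -> R[i]).

(** For small [t] the only lattice point of the dilate is 0. This keeps the supremum from being that
    of an empty set, which would be -oo. *)
Lemma admissible_nonempty : exists t, admissible eps G t.
Proof.
have [M hM] := body_bound hG.
have M0 : 0 < M.+1%:R :> R by rewrite ltr0n.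
have t0 : 0 < M.+1%:R^-1 :> R by rewrite invr_gt0.
exists M.+1%:R^-1; split=> //.
apply: (@le_trans _ _ 0); last exact: powR_ge0.
rewrite /kappa big_seq_cond; apply: bigmax_le => // y /andP[yt _].
have -> : y = 0; last by rewrite /l1norm big1 ?mul0r // => c _;
  rewrite of_latticeE /crd mxE normr0.
apply: crd_eq => c; rewrite [RHS]mxE.
have := hM _ c ((mem_points hG y t0).1 yt).
rewrite mxE of_latticeE invrK normrM gtr0_norm // -intr_norm -abszE => h.
have : (M.+1 * `|crd y c| <= M)%N by rewrite -(ler_nat R) natrM.
by case: (crd y c) => [[|n]|n] //=; nia.
Qed.

Lemma maximal_ge0 f x : (0 <= maximal eps G f x)%E.
Proof.
have [t at_] := admissible_nonempty.
apply: (@le_trans _ _ (normc (average t G f x))%:E); first by rewrite lee_fin normc_ge0.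
by apply: ereal_sup_ubound; exists t.
Qed.

Lemma maximal_le f x (r : R) :
  (forall t, admissible eps G t -> normc (average t G f x) <= r) ->
  (maximal eps G f x <= r%:E)%E.
Proof. by move=> h; apply: ge_ereal_sup => _ [t at_ <-]; rewrite lee_fin; exact: h. Qed.

(** A null set of the counting measure is empty. *)
Lemma counting_ae (P : X -> Prop) :
  (\forall x \ae (@counting X R), P x) -> forall x, P x.
Proof.
move=> [A [_ A0 PA]] x; apply: contrapT => nPx.
have Ax : A x by exact: PA.
move: A0; rewrite /counting; case: asboolP => // fA /eqP.
rewrite eqe pnatr_eq0 cardfs_eq0 => /eqP A0.
by have := mem_set Ax; rewrite -in_fset_set // A0.
Qed.

Lemma maximal_sup_norm f (C : R) : 1 <= C -> (lpnormC +oo%E f < +oo)%E ->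
  (lpnorm +oo%E (maximal eps G f) <= C%:E * lpnormC +oo%E f)%E.
Proof.
move=> C1; rewrite /lpnorm /lpnormC /lpnorm unlock; case: ifPn => muT; last by rewrite mule0.
set s := ess_sup _ _ => s_fin.
have f_le x : ((normc (f x))%:E <= s)%E.
  have := counting_ae (ess_sup_ge counting (abse \o (fun x => (normc (f x))%:E))).
  by move=> /(_ x); rewrite /= ger0_norm // normc_ge0.
have s0 : (0 <= s)%E by apply: le_trans (f_le 0); rewrite lee_fin normc_ge0.
have sE : s = (fine s)%:E by rewrite fineK // ge0_fin_numE.
apply: (@le_trans _ _ s); last first.
  by rewrite -[X in (X <= _)%E]mul1e; apply: lee_wpmul2r; rewrite ?lee_fin.
apply/ess_supP; apply: nearW => x /=.
rewrite gee0_abs ?maximal_ge0 // sE; apply: maximal_le => t at_.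
apply: (le_trans (normc_average_le _ _ _ _)); rewrite /seq_avg.
have S0 : 0 < (size (points G t))%:R :> R.
  by rewrite ltr0n; exact: (card_points_gt0 hG (@admissible_gt0 _ _ _ _) at_).
rewrite ler_pdivrMl //.
apply: (@le_trans _ _ (\sum_(y <- points G t) fine s)).
  by apply: ler_sum => y _; rewrite -lee_fin -sE.
by rewrite big_const_seq iter_addr_0 count_predT mulr_natl.
Qed.

(** By Jensen the p-th power of an average of |f| is at most the square of the average of |f|^(p/2),
    hence at most [H]. *)
Lemma maximal_lp_norm f (C p : R) (H : X -> R) : 1 <= C -> 2 <= p ->
  (forall x, 0 <= H x) ->
  (lsum H <= C%:E * lsum (fun x => (normc (f x) `^ (p / 2)) ^+ 2)%R)%E ->
  (forall t x, admissible eps G t ->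
    seq_avg (points G t) predT (fun x => normc (f x) `^ (p / 2)) x ^+ 2 <= H x) ->
  (lpnorm p%:E (maximal eps G f) <= C%:E * lpnormC p%:E f)%E.
Proof.
move=> C1 p2 H0 HI HM.
have p0 : 0 < p by lra.
have p20 : 1 <= p / 2 by lra.
have C0 : 0 <= C by lra.
have sq (u : R) : (u `^ (p / 2)) ^+ 2 = u `^ p.
  by rewrite -powR_mulrn ?powR_ge0 // -powRrM; congr (_ `^ _); field.
have M_le x : (maximal eps G f x <= (H x `^ p^-1)%:E)%E.
  apply: maximal_le => t at_; set z := normc _.
  have z0 : 0 <= z by exact: normc_ge0.
  have zp : z `^ p <= H x.
    apply: le_trans (HM t x at_); rewrite -sq.
    have g0 : 0 <= seq_avg (points G t) predT (fun x => normc (f x) `^ (p / 2)) x.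
      by apply: seq_avg_ge0 => y; exact: powR_ge0.
    rewrite lerXn2r ?nnegrE ?powR_ge0 ?g0 //.
    apply: (@le_trans _ _ (seq_avg (points G t) predT (fun y => normc (f y)) x `^ (p / 2))).
      apply: ge0_ler_powR; rewrite ?nnegrE //; first by lra.
        by apply: seq_avg_ge0 => y; exact: normc_ge0.
      exact: normc_average_le.
    apply: (@jensen_powR R X (points G t) (fun y => normc (f (x - y))) (p / 2) p20) => y.
    exact: normc_ge0.
  have -> : z = (z `^ p) `^ p^-1 by rewrite -powRrM mulfV ?powRr1 // gt_eqF.
  by apply: ge0_ler_powR; rewrite ?nnegrE ?powR_ge0 ?invr_ge0 // ltW.
rewrite /lpnorm /lpnormC /lpnorm unlock.
set I := (\int[_]_x (`|(normc (f x))%:E|%E `^ p))%E.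
have IE : I = lsum (fun x => (normc (f x) `^ (p / 2)) ^+ 2).
  by apply: eq_integral => x _; rewrite sq /= ger0_norm // normc_ge0.
have I0 : (0 <= I)%E by rewrite IE lsum_ge0 // => x; exact: sqr_ge0.
have MI : (\int[counting]_x (`|maximal eps G f x| `^ p) <= C%:E * I)%E.
  rewrite IE; apply: le_trans HI; apply: ge0_le_integral => //.
    by move=> x _; exact: poweR_ge0.
  move=> x _; rewrite gee0_abs ?maximal_ge0 //.
  have -> : (H x)%:E = ((H x `^ p^-1)%:E `^ p)%E.
    by rewrite poweR_EFin -powRrM mulVf ?powRr1 // gt_eqF.
  by apply: gt0_ler_poweR; rewrite ?in_itv /= ?leey ?andbT ?maximal_ge0 ?lee_fin ?powR_ge0 // ltW.
apply: (@le_trans _ _ ((C%:E * I) `^ p^-1)%E).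
  apply: gt0_ler_poweR; rewrite ?in_itv /= ?leey ?andbT ?invr_ge0 ?mule_ge0 ?lee_fin //.
  - exact: ltW.
  - by apply: integral_ge0 => x _; exact: poweR_ge0.
(* Since C >= 1 and 1/p <= 1, the root C^(1/p) is at most C. *)
rewrite poweRM ?lee_fin //; apply: lee_wpmul2r; first exact: poweR_ge0.
rewrite poweR_EFin lee_fin -[leRHS]powRr1 //; apply: ler_powR => //.
by rewrite invf_le1 //; lra.
Qed.

End maximal_function.

Theorem theorem1p5 (R : realType) (eps : R) (heps : 0 < eps) :
  exists C : R,
    forall (p : \bar R) (d : nat) (G : set 'rV[R]_d) (f : lattice d -> R[i]),
      (2%:E <= p)%E ->
      (0 < d)%N ->
      sym_convex_bodies G ->
      (lpnormC p f < +oo)%E ->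
      (lpnorm p (maximal eps G f) <= C%:E * lpnormC p f)%E.
Proof.
have [C C1 hC] := l2_maximal heps.
(* The value -oo of the exponent contradicts [2%:E <= p]. *)
exists C => -[p||] d G f p2 d0 hG f_fin //; last exact: maximal_sup_norm.
have [H [H0 HI HM]] := hC d G (fun x => ComplexField.Normc.normc (f x) `^ (p / 2)) d0 hG
  (fun x => powR_ge0 _ _).
have p2R : 2 <= p by rewrite -lee_fin.
exact: (maximal_lp_norm heps d0 hG C1 p2R H0 HI HM).
Qed.
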